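(* Let $K$ be a field of characteristic $0$, $F(t)=\sum_{n\ge0}a_nt^n\in K[[t]]$ with $a_0=1$, write $\log F(t)=\sum_{n\ge1}b_n\frac{t^n}{n}$, and define $R_n$ by $\sum_{n\ge0}R_nt^n=\prod_{i\ge1}F(x_it)$. Then: (a) $[s_n]R_n=a_n$ for all $n$, i.e. $\sum_{n\ge0}[s_n]R_nt^n=F(t)$. Moreover, for any homogeneous symmetric function $f$ of degree $n$, $[s_n]f$ equals the sum of the coefficients in the $h$-expansion of $f$. (b) $\sum_{n\ge0}[s_{1^n}]R_nt^n=\frac{1}{F(-t)}$. (c) For fixed $k\ge1$, $\sum_{n\ge0}[h_k^n]R_{kn}\,t^n=\exp\left(-\sum_{i\ge1}b_{ki}\frac{(-t)^i}{i}\right)$, i.e. $1/F(-t)$ with each $b_i$ replaced by $b_{ki}$. In particular $[h_n]R_n=b_n$. (d) If $i,j\ge1$ and $i+j=n$, then $[h_ih_j]R_n=b_ib_j-b_n$ if $i\ne j$, and $[h_ih_j]R_n=\frac12(b_i^2-b_n)$ if $i=j$. (e) For $k\ge 0$, $\sum_{n\ge0}R_n(1^k)t^n=F(t)^k$, where $R_n(1^k)$ denotes $R_n$ evaluated at $x_1=\cdots=x_k=1$, $x_{k+1}=x_{k+2}=\cdots=0$. (f) Let $u$ be an indeterminate and write $\frac{F(t)}{F(-ut)}=\sum_{n\ge0}P_n(u)t^n$. Then for $n\ge1$, $P_n(u)$ is a polynomial in $u$ of degree at most $n$ divisible by $1+u$, and $$\frac{P_n(u)}{1+u}=\sum_{k=0}^{n-1}\left([s_{(n-k,1^k)}]R_n\right)u^k,$$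 where $(n-k,1^k)$ denotes the hook partition with one part $n-k$ and $k$ parts equal to $1$.
   Context: For a basis $\{b_\lambda\}$ of symmetric functions, $[b_\lambda]f$ is the coefficient of $b_\lambda$ in the expansion of $f$. $s_\lambda$ are Schur functions, $h_\lambda$ complete homogeneous symmetric functions; $h_k^n$ means $h_{(k,k,\dots,k)}$ with $n$ parts, $s_n=s_{(n)}$, $s_{1^n}=s_{(1,\dots,1)}$. *)

(* Defs.v *)
From mathcomp Require Import all_boot all_order all_algebra.
From mathcomp Require Import mpoly.
From Stdlib Require Import ClassicalEpsilon.

Set Implicit Arguments.
Unset Strict Implicit.
Unset Printing Implicit Defensive.

Import GRing.Theory.
Local Open Scope ring_scope.

(** * Formal power series *)

(* A series sum_n (f n) t^n in A[[t]] is its coefficient sequence f. *)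
Definition fps (A : comNzRingType) := nat -> A.

Section PowerSeries.
Variable A : comNzRingType.
Implicit Types (f g c : fps A).

Definition fps_one : fps A := fun n => (n == 0%N)%:R.
Definition fps_add f g : fps A := fun n => f n + g n.
Definition fps_opp f : fps A := fun n => - f n.
Definition fps_mul f g : fps A := fun n => \sum_(i < n.+1) f i * g (n - i)%N.
Definition fps_pow f k : fps A := iter k (fps_mul f) fps_one.

(* f(z t) *)
Definition fps_dil (z : A) f : fps A := fun n => z ^+ n * f n.

(* sum_m (c m) g(t)^m, for g with zero constant term: as g^m has order >= m,
   only the terms m <= n contribute to t^n. *)
Definition fps_comp c g : fps A :=
  fun n => \sum_(m < n.+1) c m * fps_pow g m n.

(* 1/f = sum_m (1 - f)^m, for f with constant term 1. *)
Definition fps_inv f : fps A :=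
  fps_comp (fun=> 1) (fps_add fps_one (fps_opp f)).

End PowerSeries.

Section ExpLog.
Variable K : fieldType.

(* exp g, for g with zero constant term. *)
Definition fps_exp (g : fps K) : fps K := fps_comp (fun m => (m`!%:R)^-1) g.

(* log f = sum_(m >= 1) (-1)^(m-1) (f - 1)^m / m, for f with constant term 1. *)
Definition fps_log (f : fps K) : fps K :=
  fps_comp (fun m => if m is m'.+1 then (-1) ^+ m' / m%:R else 0)
           (fps_add f (fps_opp (fps_one K))).

(* The series sum_(i >= 1) (b i) t^i / i. *)
Definition fps_logser (b : nat -> K) : fps K :=
  fun i => if i is 0 then 0 else b i / i%:R.

End ExpLog.

(** * Partitions and symmetric functions *)

Definition is_partn (n : nat) (l : seq nat) : bool :=
  [&& sorted geq l, 0%N \notin l & sumn l == n].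

(* The partition (n), which is the empty partition when n = 0. *)
Definition row_partn (n : nat) : seq nat := if n is 0 then [::] else [:: n].

(* The list of all partitions of n: such a partition has at most n parts, all at
   most n. *)
Definition partns (n : nat) : seq (seq nat) :=
  [seq l <- [seq map val t | t : {bseq n of 'I_n.+1}] | is_partn n l].

Lemma partns_uniq n : uniq (partns n).
Proof.
rewrite filter_uniq // map_inj_uniq ?enum_uniq // => s t /inj_map eq_st.
by apply/val_inj/eq_st/val_inj.
Qed.

Lemma mem_partns n l : (l \in partns n) = is_partn n l.
Proof.
rewrite mem_filter; case: (boolP (is_partn n l)) => //= /and3P[_ l0 /eqP suml].
have lt_l k : k \in l -> (k < n.+1)%N.
  move=> kl; rewrite ltnS -suml sumnE (perm_big _ (perm_to_rem kl)) big_cons.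
  exact: leq_addr.
have size_l : (size l <= n)%N.
  rewrite -suml {lt_l suml}; elim: l l0 => //= k l IHl.
  by rewrite inE negb_or eq_sym -lt0n => /andP[k0 /IHl le_l]; rewrite -add1n leq_add.
have size_s : (size [seq inord k : 'I_n.+1 | k <- l] <= n)%N by rewrite size_map.
apply/mapP; exists (Bseq size_s); first exact: mem_enum.
rewrite /= -map_comp map_id_in // => k /lt_l lt_k /=.
by rewrite inordK.
Qed.

Section SymmetricFunctions.
Variable K : fieldType.

(* The ring of symmetric functions is taken as the inverse limit of the rings of
   symmetric polynomials: f N is f(x_1, ..., x_N, 0, 0, ...). *)
Definition varfam := forall N : nat, {mpoly K[N]}.

Definition drop_last_var N (p : {mpoly K[N.+1]}) : {mpoly K[N]} :=
  p \mPo [tuple oapp (fun j : 'I_N => 'X_j) 0 (unlift ord_max i) | i < N.+1].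

Definition homog_symfun (n : nat) (f : varfam) : Prop :=
  [/\ forall N, f N \is symmetric,
      forall N, f N \is n.-homog
    & forall N, drop_last_var (f N.+1) = f N].

(* f(1^k): x_1 = ... = x_k = 1 and x_i = 0 for i > k. *)
Definition eval_ones (k : nat) (f : varfam) : K := (f k).@[fun=> 1].

Definition hsym (k : nat) : varfam :=
  fun N => \sum_(m : 'X_{1..N < k.+1} | mdeg m == k) 'X_[m].

Definition hfun (l : seq nat) : varfam := fun N => \prod_(k <- l) hsym k N.

(* Cells (i, j) of the Young diagram of l: row i, column j, from 0. *)
Definition cell (l : seq nat) : finType :=
  {p : 'I_(size l) * 'I_(head 0%N l) | (p.2 < nth 0%N l p.1)%N}.

Definition is_ssyt (l : seq nat) N (T : {ffun cell l -> 'I_N}) : bool :=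
  [forall p : cell l, forall q : cell l,
     let: (i, j) := val p in let: (i', j') := val q in
     ((i == i') && (j <= j')%N ==> (T p <= T q)%N) &&
     ((j == j') && (i < i')%N ==> (T p < T q)%N)].

Definition schur (l : seq nat) : varfam :=
  fun N => \sum_(T : {ffun cell l -> 'I_N} | is_ssyt T) \prod_(p : cell l) 'X_(T p).

Definition is_expansion (b : seq nat -> varfam) (n : nat) (f : varfam)
    (c : seq nat -> K) : Prop :=
  forall N, f N = \sum_(l <- partns n) c l *: b l N.

(* [b_l] f for f homogeneous of degree n and l a partition of n: the l-th
   coefficient of the expansion of f in (b_m), m ranging over the partitions of
   n. The choice of c is irrelevant when (b_m) is a basis in degree n. *)
Definition bcoef (b : seq nat -> varfam) (n : nat) (f : varfam) (l : seq nat) : K :=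
  epsilon (inhabits (fun=> 0)) (is_expansion b n f) l.

(* R_n, the coefficient of t^n in prod_(i >= 1) F(x_i t). As F(0) = 1, putting
   x_i = 0 for all i > N leaves the product over i <= N, in K[x_1,...,x_N][[t]]. *)
Definition Rfun (F : fps K) (n : nat) : varfam :=
  fun N => (\big[@fps_mul {mpoly K[N]}/fps_one {mpoly K[N]}]_(i < N)
              fps_dil 'X_i (fun m => (F m)%:MP)) n.

End SymmetricFunctions.

(* Main.v *)
(* Write R(F) for the product of the F(x_i t). Since R(F G) = R(F) R(G), the series
   H(t) = sum h_k t^k and E(t) = sum e_k t^k satisfy H(t) E(-t) = 1. The relation is
   symmetric in H and E, so the fundamental theorem passes from the e_k to the h_k:
   symmetric polynomials are polynomials in the h_k, uniquely. From t F' = F sum b_k t^k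
   one gets t R(F)' = R(F) sum b_k p_k t^k. Hence a ring morphism sending H to a series
   with logarithmic derivative sum pi_k t^k sends R(F) to the series with logarithmic
   derivative sum b_k pi_k t^k. Sending H to 1 + t^k gives (c); sending H to
   1 + X (t^i + t^j) and extracting the part quadratic in X gives (d).

   Removing the largest entry of a tableau matches the expansion of an alternant obtained
   by column operations, which yields the bialternant formula a_delta s_l = a_(l+delta).
   Thus Schur polynomials are symmetric and free, and the coefficient of s_l in f is that
   of x^(l+delta) in a_delta f. For f = R_n it is the determinant of a_(l_i - i + j),
   whose first column has only two nonzero entries when l is a hook; the recursion so
   obtained gives (b) and (f). For l = (n) a single variable is enough, which gives (a). *)
Require Import Defs.
From HB Require Import structures.
From mathcomp Require Import all_boot all_order all_algebra.
From mathcomp Require Import fingroup perm mpoly zify ring boolp.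
From Stdlib Require Import ClassicalEpsilon.

Set Implicit Arguments.
Unset Strict Implicit.
Unset Printing Implicit Defensive.

Import GRing.Theory.
Local Open Scope ring_scope.

(** * Formal power series *)

Section FpsRing.
Variable A : comNzRingType.
Implicit Types f g h : fps A.

HB.instance Definition _ := gen_eqMixin (fps A).
HB.instance Definition _ := gen_choiceMixin (fps A).

Lemma fps_ext f g : f =1 g -> f = g.
Proof. exact: funext. Qed.

Definition fps_zero : fps A := fun=> 0.

Lemma fps_addA : associative (@fps_add A).
Proof. by move=> f g h; apply/fps_ext => n; apply: addrA. Qed.

Lemma fps_addC : commutative (@fps_add A).
Proof. by move=> f g; apply/fps_ext => n; apply: addrC. Qed.

Lemma fps_add0f : left_id fps_zero (@fps_add A).
Proof. by move=> f; apply/fps_ext => n; apply: add0r. Qed.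

Lemma fps_addNf : left_inverse fps_zero (@fps_opp A) (@fps_add A).
Proof. by move=> f; apply/fps_ext => n; apply: addNr. Qed.

HB.instance Definition _ :=
  GRing.isZmodule.Build (fps A) fps_addA fps_addC fps_add0f fps_addNf.

Definition fps_trunc M f : {poly A} := \poly_(i < M) f i.

Lemma coef_mul_fps_trunc M f (p : {poly A}) : (forall n, (n < M)%N -> p`_n = f n) ->
  forall g n, (n < M)%N -> (p * fps_trunc M g)`_n = fps_mul f g n.
Proof.
move=> eq_pf g n ltnM; rewrite coefM; apply: eq_bigr => i _.
by rewrite eq_pf ?coef_poly ?ifT //; have := ltn_ord i; lia.
Qed.

Lemma coef_fps_truncM M f g n :
  (n < M)%N -> (fps_trunc M f * fps_trunc M g)`_n = fps_mul f g n.
Proof. by apply: coef_mul_fps_trunc => i ltiM; rewrite coef_poly ltiM. Qed.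

Lemma fps_mulC : commutative (@fps_mul A).
Proof. by move=> f g; apply/fps_ext => n; rewrite -!(@coef_fps_truncM n.+1) // mulrC. Qed.

Lemma fps_mulA : associative (@fps_mul A).
Proof.
move=> f g h; apply/fps_ext => n; rewrite fps_mulC.
have truncM f1 f2 := @coef_fps_truncM n.+1 f1 f2.
rewrite -(coef_mul_fps_trunc (truncM g h)) // -(coef_mul_fps_trunc (truncM f g)) //.
by rewrite mulrC mulrA.
Qed.

Lemma fps_mul1f : left_id (fps_one A) (@fps_mul A).
Proof.
move=> f; apply/fps_ext => n; rewrite /fps_mul big_ord_recl subn0 mul1r.
by rewrite big1 ?addr0 // => i _; rewrite mul0r.
Qed.

Lemma fps_mulDl : left_distributive (@fps_mul A) (@fps_add A).
Proof.
move=> f g h; apply/fps_ext => n; rewrite /fps_add /fps_mul -big_split.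
by apply: eq_bigr => i _; rewrite mulrDl.
Qed.

Lemma fps_one_neq0 : fps_one A != 0.
Proof. by apply/eqP => /(congr1 (fun f : fps A => f 0%N)) /eqP; rewrite oner_eq0. Qed.

HB.instance Definition _ := GRing.Zmodule_isComNzRing.Build (fps A)
  fps_mulA fps_mulC fps_mul1f fps_mulDl fps_one_neq0.

Lemma coef_fps1 n : (1 : fps A) n = (n == 0%N)%:R. Proof. by []. Qed.
Lemma coef_fpsD f g n : (f + g) n = f n + g n. Proof. by []. Qed.
Lemma coef_fpsN f n : (- f) n = - f n. Proof. by []. Qed.
Lemma coef_fpsM f g n : (f * g) n = \sum_(i < n.+1) f i * g (n - i)%N. Proof. by []. Qed.
Lemma coef0_fpsM f g : (f * g) 0%N = f 0%N * g 0%N.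
Proof. by rewrite coef_fpsM big_ord1. Qed.

Lemma fps_powE f k : fps_pow f k = f ^+ k.
Proof. by elim: k => // k IHk; rewrite exprS -IHk. Qed.

Lemma coef_fps_sum I (r : seq I) (P : pred I) (F : I -> fps A) n :
  (\sum_(i <- r | P i) F i) n = \sum_(i <- r | P i) F i n.
Proof. by elim/big_rec2: _ => // i x f _ <-. Qed.

End FpsRing.

Section FpsMorphisms.
Variables A B : comNzRingType.

Definition fps_map (phi : A -> B) (f : fps A) : fps B := fun n => phi (f n).

Section Map.
Variable phi : {rmorphism A -> B}.

Lemma fps_map_is_zmod_morphism : zmod_morphism (fps_map phi).
Proof. by move=> f g; apply/fps_ext => n; apply: rmorphB. Qed.

Lemma fps_map_is_monoid_morphism : monoid_morphism (fps_map phi).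
Proof.
split=> [|f g]; apply/fps_ext => n; first exact: rmorph_nat.
by rewrite /fps_map !coef_fpsM rmorph_sum; apply: eq_bigr => i _; rewrite rmorphM.
Qed.

HB.instance Definition _ := GRing.isZmodMorphism.Build (fps A) (fps B)
  (fps_map phi) fps_map_is_zmod_morphism.
HB.instance Definition _ := GRing.isMonoidMorphism.Build (fps A) (fps B)
  (fps_map phi) fps_map_is_monoid_morphism.

End Map.

Section Dilation.
Variable z : A.

Lemma fps_dil_is_zmod_morphism : zmod_morphism (fps_dil z).
Proof. by move=> f g; apply/fps_ext => n; apply: mulrBr. Qed.

Lemma fps_dil_is_monoid_morphism : monoid_morphism (fps_dil z).
Proof.
split=> [|f g]; apply/fps_ext => n; rewrite /fps_dil.
  by case: n => [|n]; rewrite !coef_fps1 ?mulr0 // expr0 mul1r.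
rewrite !coef_fpsM mulr_sumr; apply: eq_bigr => i _.
by rewrite mulrACA -exprD subnKC // -ltnS.
Qed.

HB.instance Definition _ := GRing.isZmodMorphism.Build (fps A) (fps A)
  (fps_dil z) fps_dil_is_zmod_morphism.
HB.instance Definition _ := GRing.isMonoidMorphism.Build (fps A) (fps A)
  (fps_dil z) fps_dil_is_monoid_morphism.

End Dilation.

End FpsMorphisms.

Lemma fps_map_dil (A B : comNzRingType) (phi : {rmorphism A -> B}) z f :
  fps_map phi (fps_dil z f) = fps_dil (phi z) (fps_map phi f).
Proof. by apply/fps_ext => n; rewrite /fps_map /fps_dil rmorphM rmorphXn. Qed.

Section LogDerivative.
Variable A : comNzRingType.
Implicit Types f g c d : fps A.

Lemma coef0_fps_dil z f : fps_dil z f 0%N = f 0%N.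
Proof. exact: mul1r. Qed.

Lemma fps_dilA y z f : fps_dil y (fps_dil z f) = fps_dil (y * z) f.
Proof. by apply/fps_ext => n; rewrite /fps_dil exprMn mulrA. Qed.

Lemma fps_dil1 f : fps_dil 1 f = f.
Proof. by apply/fps_ext => n; rewrite /fps_dil expr1n mul1r. Qed.

Lemma coef_fpsX_lt f m n : f 0%N = 0 -> (n < m)%N -> (f ^+ m) n = 0.
Proof.
move=> f0; elim: m n => // m IHm n ltnm; rewrite exprS coef_fpsM big_ord_recl f0 mul0r add0r.
by rewrite big1 // => i _; rewrite IHm ?mulr0 // lift0; have := ltn_ord i; lia.
Qed.

Lemma coef_fps_comp c g M n :
  g 0%N = 0 -> (n < M)%N -> fps_comp c g n = \sum_(m < M) c m * (g ^+ m) n.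
Proof.
move=> g0 ltnM; rewrite /fps_comp (big_ord_widen M (fun m => c m * fps_pow g m n)) //.
rewrite big_mkcond; apply: eq_bigr => m _; rewrite fps_powE.
by case: ltnP => // ltnm; rewrite coef_fpsX_lt ?mulr0.
Qed.

Lemma coef0_fps_comp c g : fps_comp c g 0%N = c 0%N.
Proof. by rewrite /fps_comp big_ord1 mulr1. Qed.

Lemma coef0_fps_inv f : fps_inv f 0%N = 1.
Proof. exact: coef0_fps_comp. Qed.

Lemma fps_mulV f : f 0%N = 1 -> f * fps_inv f = 1.
Proof.
move=> f0; apply/fps_ext => n; pose g := 1 - f.
have g0 : g 0%N = 0 by rewrite /g coef_fpsD coef_fpsN f0 subrr.
transitivity ((f * \sum_(m < n.+1) g ^+ m) n).
  rewrite !coef_fpsM; apply: eq_bigr => i _; congr (_ * _).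
  rewrite [LHS](@coef_fps_comp _ g n.+1) ?ltnS ?leq_subr //.
  by rewrite coef_fps_sum; apply: eq_bigr => m _; rewrite mul1r.
have -> : f = - (g - 1) by rewrite /g; ring.
by rewrite mulNr -subrX1 coef_fpsN coef_fpsD coef_fpsX_lt // add0r coef_fpsN opprK.
Qed.

Lemma fps_inv_unique f g : f 0%N = 1 -> f * g = 1 -> g = fps_inv f.
Proof. by move=> f0 fg1; rewrite -[LHS]mul1r -(fps_mulV f0) mulrAC fg1 mul1r. Qed.

Lemma fps_invK f : f 0%N = 1 -> fps_inv (fps_inv f) = f.
Proof.
by move=> f0; apply/esym/fps_inv_unique; rewrite ?coef0_fps_inv // mulrC fps_mulV.
Qed.

Lemma fps_inv_dil z f : f 0%N = 1 -> fps_inv (fps_dil z f) = fps_dil z (fps_inv f).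
Proof.
move=> f0; apply/esym/fps_inv_unique; first by rewrite coef0_fps_dil.
by rewrite -rmorphM fps_mulV // rmorph1.
Qed.

(* The derivation t d/dt. *)
Definition fps_theta f : fps A := fun n => n%:R * f n.

Lemma fps_theta_is_zmod_morphism : zmod_morphism fps_theta.
Proof. by move=> f g; apply/fps_ext => n; apply: mulrBr. Qed.

HB.instance Definition _ := GRing.isZmodMorphism.Build (fps A) (fps A)
  fps_theta fps_theta_is_zmod_morphism.

Lemma fps_theta1 : fps_theta 1 = 0.
Proof. by apply/fps_ext => -[|n]; [apply: mul0r|apply: mulr0]. Qed.

Lemma fps_thetaM f g : fps_theta (f * g) = fps_theta f * g + f * fps_theta g.
Proof.
apply/fps_ext => n; rewrite coef_fpsD !coef_fpsM /fps_theta coef_fpsM mulr_sumr -big_split.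
apply: eq_bigr => i _ /=.
have -> : n%:R = i%:R + (n - i)%:R :> A by rewrite -natrD subnKC // -ltnS.
by ring.
Qed.

Lemma fps_thetaX f m : fps_theta (f ^+ m) = m%:R * f ^+ m.-1 * fps_theta f.
Proof.
elim: m => [|m IHm]; first by rewrite fps_theta1 !mul0r.
rewrite exprS fps_thetaM IHm; case: m {IHm} => [|m] /=; first by ring.
by rewrite exprS -[m.+2%:R]natr1; ring.
Qed.

Lemma fps_theta_dil z f : fps_theta (fps_dil z f) = fps_dil z (fps_theta f).
Proof. by apply/fps_ext => n; apply: mulrCA. Qed.

Lemma coef_fps_natrM m f n : (m%:R * f) n = m%:R * f n.
Proof. by rewrite !mulr_natl; elim: m => // m IHm; rewrite !mulrS -IHm. Qed.

Lemma fps_theta_comp c g : g 0%N = 0 ->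
  fps_theta (fps_comp c g) = fps_comp (fun m => m.+1%:R * c m.+1) g * fps_theta g.
Proof.
move=> g0; apply/fps_ext => n; rewrite [RHS]coef_fpsM.
transitivity (\sum_(m < n.+1) m.+1%:R * c m.+1 * (g ^+ m * fps_theta g) n).
  rewrite {1}/fps_theta (@coef_fps_comp _ _ n.+2) // mulr_sumr.
  transitivity (\sum_(m < n.+2) m%:R * c m * (g ^+ m.-1 * fps_theta g) n).
    apply: eq_bigr => m _; rewrite mulrCA -[n%:R * _]/(fps_theta (g ^+ m) n).
    by rewrite fps_thetaX -mulrA coef_fps_natrM mulrCA mulrA.
  by rewrite big_ord_recl !mul0r add0r.
under eq_bigr do rewrite coef_fpsM mulr_sumr.
rewrite exchange_big; apply: eq_bigr => i _ /=.
rewrite (@coef_fps_comp _ _ n.+1) // mulr_suml.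
by apply: eq_bigr => m _; rewrite mulrA.
Qed.

Definition fps_logder f c : Prop := fps_theta f = c * f.

Lemma fps_logder1 : fps_logder 1 0.
Proof. by rewrite /fps_logder fps_theta1 mul0r. Qed.

Lemma fps_logderM f g c d : fps_logder f c -> fps_logder g d -> fps_logder (f * g) (c + d).
Proof. by rewrite /fps_logder fps_thetaM => -> ->; ring. Qed.

Lemma fps_logder_dil z f c : fps_logder f c -> fps_logder (fps_dil z f) (fps_dil z c).
Proof. by rewrite /fps_logder fps_theta_dil => ->; rewrite rmorphM. Qed.

Lemma fps_logderE f c : f 0%N = 1 -> fps_logder f c <-> c = fps_theta f * fps_inv f.
Proof.
move=> f0; split=> [->|->]; first by rewrite -mulrA fps_mulV // mulr1.
by rewrite /fps_logder mulrAC -mulrA fps_mulV // mulr1.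
Qed.

Lemma fps_logderV f c : f 0%N = 1 -> fps_logder f c -> fps_logder (fps_inv f) (- c).
Proof.
move=> f0 fc; have := fps_theta1; rewrite -(fps_mulV f0) fps_thetaM fc -mulrA fps_mulV //.
rewrite mulr1 => /eqP; rewrite addrC addr_eq0 => /eqP f_thV.
by rewrite /fps_logder -[LHS]mul1r -(fps_mulV f0) mulrAC f_thV; ring.
Qed.

Lemma fps_logder_coef0 f c : fps_logder f c -> f 0%N = 1 -> c 0%N = 0.
Proof.
move=> fc f0; have := congr1 (fun h : fps A => h 0%N) fc.
by rewrite /fps_theta mul0r coef0_fpsM f0 mulr1.
Qed.

End LogDerivative.

Lemma fps_theta_map (A B : comNzRingType) (phi : {rmorphism A -> B}) f :
  fps_theta (fps_map phi f) = fps_map phi (fps_theta f).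
Proof. by apply/fps_ext => n; rewrite /fps_theta /fps_map rmorphM rmorph_nat. Qed.

Lemma fps_logder_map (A B : comNzRingType) (phi : {rmorphism A -> B}) f c :
  fps_logder f c -> fps_logder (fps_map phi f) (fps_map phi c).
Proof. by rewrite /fps_logder fps_theta_map => ->; rewrite rmorphM. Qed.

Lemma fps_map_inv (A B : comNzRingType) (phi : {rmorphism A -> B}) f :
  f 0%N = 1 -> fps_map phi (fps_inv f) = fps_inv (fps_map phi f).
Proof.
move=> f0; apply: fps_inv_unique; first by rewrite /fps_map f0 rmorph1.
by rewrite -rmorphM fps_mulV // rmorph1.
Qed.

Section FpsAgreement.
Variables (A : comNzRingType) (M : nat).
Implicit Types f g c d : fps A.

Definition fps_agree f g : Prop := forall n, (n <= M)%N -> f n = g n.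

Lemma fps_agreeM f g c d : fps_agree f g -> fps_agree c d -> fps_agree (f * c) (g * d).
Proof.
move=> fg cd n lenM; rewrite !coef_fpsM; apply: eq_bigr => i _.
by rewrite fg ?cd //; have := ltn_ord i; lia.
Qed.

Lemma fps_agree_theta f g : fps_agree f g -> fps_agree (fps_theta f) (fps_theta g).
Proof. by move=> fg n lenM; rewrite /fps_theta fg. Qed.

Lemma fps_agree_dil z f g : fps_agree f g -> fps_agree (fps_dil z f) (fps_dil z g).
Proof. by move=> fg n lenM; rewrite /fps_dil fg. Qed.

Lemma fps_agree_inv f g :
  f 0%N = 1 -> fps_agree f g -> fps_agree (fps_inv f) (fps_inv g).
Proof.
move=> f0 fg; have g0 : g 0%N = 1 by rewrite -fg.
have -> : fps_inv f = g * (fps_inv f * fps_inv g).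
  by rewrite mulrCA fps_mulV ?mulr1.
have {2}-> : fps_inv g = f * (fps_inv f * fps_inv g) by rewrite mulrA fps_mulV ?mul1r.
by apply: fps_agreeM => // n lenM; rewrite fg.
Qed.

Lemma fps_agree_logder f g c d : f 0%N = 1 -> fps_logder f c -> fps_logder g d ->
  fps_agree f g -> fps_agree c d.
Proof.
move=> f0 fc gd fg; have g0 : g 0%N = 1 by rewrite -fg.
move: fc gd => /(fps_logderE _ f0)-> /(fps_logderE _ g0)->.
by apply: fps_agreeM; [apply: fps_agree_theta|apply: fps_agree_inv].
Qed.

Lemma fps_agree_of_logder f g c d : (forall n, GRing.lreg (n.+1%:R : A)) ->
    f 0%N = 1 -> g 0%N = 1 -> fps_logder f c -> fps_logder g d ->
  fps_agree c d -> fps_agree f g.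
Proof.
move=> regA f0 g0 fc gd cd; have c0 := fps_logder_coef0 fc f0.
have d0 := fps_logder_coef0 gd g0.
elim/ltn_ind => -[_ _|n IHn ltnM]; first by rewrite f0 g0.
apply: (regA n); rewrite -[LHS]/(fps_theta f n.+1) -[RHS]/(fps_theta g n.+1) fc gd.
rewrite !coef_fpsM [LHS]big_ord_recl [RHS]big_ord_recl c0 d0 !mul0r; congr (_ + _).
by apply: eq_bigr => i _; rewrite lift0 cd ?IHn //; have := ltn_ord i; lia.
Qed.

End FpsAgreement.

Lemma fps_logder_unique (A : comNzRingType) (f g c : fps A) :
    (forall n, GRing.lreg (n.+1%:R : A)) -> f 0%N = 1 -> g 0%N = 1 ->
  fps_logder f c -> fps_logder g c -> f = g.
Proof.
move=> regA f0 g0 fc gc; apply/fps_ext => n.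
exact: (@fps_agree_of_logder _ n _ _ c c).
Qed.

Lemma sum_multiples (V : nmodType) (F : nat -> V) k n : (0 < k)%N ->
  \sum_(i < n.+1) (if (k %| i)%N then F (i %/ k)%N else 0) = \sum_(j < (n %/ k).+1) F j.
Proof.
move=> k_gt0; elim: n => [|n IHn]; first by rewrite div0n !big_ord1 dvdn0 div0n.
rewrite big_ord_recr IHn /=; case: ifP => [kn|/negbT kn].
  by rewrite divnS // kn add1n [RHS]big_ord_recr.
by rewrite divnS // (negPf kn) addr0.
Qed.

Section FpsExpansion.
Variables (A : comNzRingType) (k : nat).
Hypothesis k_gt0 : (0 < k)%N.
Implicit Types f g c : fps A.

(* f(t^k) *)
Definition fps_expand f : fps A := fun n => if (k %| n)%N then f (n %/ k)%N else 0.

Lemma coef_fps_expand f n : fps_expand f (k * n)%N = f n.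
Proof. by rewrite /fps_expand dvdn_mulr // mulKn. Qed.

Lemma fps_expandM f g : fps_expand (f * g) = fps_expand f * fps_expand g.
Proof.
apply/fps_ext => n; rewrite [RHS]coef_fpsM /fps_expand; case: ifP => [kn|/negbT kn].
  rewrite coef_fpsM -(sum_multiples (fun j => f j * g (n %/ k - j)%N)) //.
  apply: eq_bigr => i _; case: ifP => [ki|_]; last by rewrite mul0r.
  by rewrite dvdn_subl ?leq_ord // kn divnBr.
rewrite big1 // => i _; case: ifP => [ki|_]; last by rewrite mul0r.
by rewrite dvdn_subl ?leq_ord // (negPf kn) mulr0.
Qed.

Lemma fps_logder_expand f c :
  fps_logder f c -> fps_logder (fps_expand f) (fps_expand (k%:R * c)).
Proof.
move=> fc; rewrite /fps_logder -fps_expandM -mulrA -fc; apply/fps_ext => n.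
rewrite /fps_theta /fps_expand; case: ifP => [kn|_]; last by rewrite mulr0.
by rewrite coef_fps_natrM mulrA -natrM mulnC divnK.
Qed.

End FpsExpansion.

Section ExpLogTheory.
Variable K : fieldType.
Hypothesis charK0 : [pchar K] =i pred0.
Implicit Types f g : fps K.

Lemma natrS_neq0 n : n.+1%:R != 0 :> K.
Proof. by rewrite ((pcharf0P K).1 charK0). Qed.

Lemma natrS_lreg (L : comNzRingType) (phi : {rmorphism K -> L}) n :
  GRing.lreg (n.+1%:R : L).
Proof.
apply: (can_inj (g := *%R (phi n.+1%:R^-1))) => x.
by rewrite mulrA -(rmorph_nat phi) -rmorphM mulVf ?natrS_neq0 // rmorph1 mul1r.
Qed.

Lemma coef0_fps_exp g : fps_exp g 0%N = 1.
Proof. by rewrite [LHS]coef0_fps_comp invr1. Qed.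

Lemma coef1_fps_exp g : g 0%N = 0 -> fps_exp g 1%N = g 1%N.
Proof.
move=> g0; rewrite [LHS](@coef_fps_comp _ _ _ 2) // !big_ord_recl big_ord0 /=.
by rewrite [_ 1%N]coef_fps1 mulr0 add0r addr0 invr1 mul1r expr1.
Qed.

Lemma fps_logder_expL (L : comNzRingType) (phi : {rmorphism K -> L}) (g : fps L) :
  g 0%N = 0 -> fps_logder (fps_comp (fun m => phi m`!%:R^-1) g) (fps_theta g).
Proof.
move=> g0; rewrite /fps_logder mulrC fps_theta_comp //; congr (fps_comp _ _ * _).
apply/fps_ext => m; rewrite -(rmorph_nat phi) -rmorphM factS natrM invfM.
by rewrite mulVKf ?natrS_neq0.
Qed.

Lemma fps_logder_exp g : g 0%N = 0 -> fps_logder (fps_exp g) (fps_theta g).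
Proof. exact: (@fps_logder_expL _ idfun). Qed.

Lemma fps_logder_solution (L : comNzRingType) (phi : {rmorphism K -> L}) (c : fps L) :
  c 0%N = 0 -> exists2 f : fps L, f 0%N = 1 & fps_logder f c.
Proof.
move=> c0; pose g : fps L := fun n => phi n%:R^-1 * c n.
have g0 : g 0%N = 0 by rewrite /g c0 mulr0.
exists (fps_comp (fun m => phi m`!%:R^-1) g).
  by rewrite coef0_fps_comp invr1 rmorph1.
have -> : c = fps_theta g; last exact: fps_logder_expL.
apply/fps_ext => -[|n]; first by rewrite /fps_theta mul0r.
by rewrite /fps_theta mulrA -(rmorph_nat phi) -rmorphM divff ?natrS_neq0 // rmorph1 mul1r.
Qed.

Lemma fps_theta_inj f g : fps_theta f = fps_theta g -> f 0%N = g 0%N -> f = g.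
Proof.
move=> eq_th eq0; apply/fps_ext => -[//|n].
exact/(mulfI (natrS_neq0 n))/(congr1 (fun h : fps K => h n.+1) eq_th).
Qed.

Lemma coef_fps_signM m f n : ((-1) ^+ m * f) n = (-1) ^+ m * f n.
Proof. by rewrite -!(signr_odd _ m); case: (odd m); rewrite ?mul1r // !mulN1r. Qed.

Lemma fps_logder_log f : f 0%N = 1 -> fps_logder f (fps_theta (fps_log f)).
Proof.
move=> f0; have g0 : (f - 1) 0%N = 0 by rewrite coef_fpsD f0 subrr.
rewrite fps_logderE // [LHS](fps_theta_comp _ g0) mulrC; congr (_ * _).
  by rewrite raddfB /= fps_theta1 subr0.
apply/fps_ext => n; apply: eq_bigr => m _; rewrite !fps_powE mul1r.
rewrite [_%:R * _]mulrC divfK ?natrS_neq0 // -coef_fps_signM; congr (_ n).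
by rewrite -exprNn opprB.
Qed.

Lemma fps_inv_exp g : g 0%N = 0 ->
  fps_inv (fps_dil (-1) (fps_exp g)) = fps_exp (- fps_dil (-1) g).
Proof.
move=> g0; have dil0 : fps_dil (-1) (fps_exp g) 0%N = 1.
  by rewrite coef0_fps_dil coef0_fps_exp.
have Ndil0 : (- fps_dil (-1) g) 0%N = 0 by rewrite coef_fpsN coef0_fps_dil g0 oppr0.
apply: (@fps_logder_unique _ _ _ (fps_theta (- fps_dil (-1) g))).
- exact: (natrS_lreg idfun).
- exact: coef0_fps_inv.
- exact: coef0_fps_exp.
- rewrite raddfN /= fps_theta_dil; apply: fps_logderV => //.
  exact/fps_logder_dil/fps_logder_exp.
exact: fps_logder_exp.
Qed.

End ExpLogTheory.

Section GeometricSeries.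
Variable A : comNzRingType.

Definition fps_geom : fps A := fun=> 1.

Definition fps_1addX : fps A := fun n => (n <= 1)%:R.

Lemma fps_inv_dil_geom : fps_inv (fps_dil (-1) fps_geom) = fps_1addX.
Proof.
apply/esym/fps_inv_unique; first exact: coef0_fps_dil.
apply/fps_ext => n; rewrite mulrC coef_fpsM /fps_dil.
case: n => [|n]; first by rewrite big_ord1 !mulr1.
rewrite !big_ord_recl big1 => [|i _]; last by rewrite mul0r.
by rewrite !mul1r !mulr1 subn0 subn1 /= exprS mulN1r addr0 addNr.
Qed.

Lemma fps_logder_geom : fps_logder fps_geom (fps_geom - 1).
Proof.
apply/fps_ext => n; rewrite mulrBl mul1r coef_fpsD coef_fpsN coef_fpsM.
under eq_bigr do rewrite mulr1.
by rewrite sumr_const card_ord -natr1 /fps_theta mulr1 addrK.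
Qed.

Lemma fps_logder_1addX : fps_logder fps_1addX (- fps_dil (-1) (fps_geom - 1)).
Proof.
rewrite -fps_inv_dil_geom; apply: fps_logderV; first exact: coef0_fps_dil.
exact/fps_logder_dil/fps_logder_geom.
Qed.

End GeometricSeries.

(** * The symmetric functions R_n *)

Lemma coef_fps_trunc_prod (A : comNzRingType) N (f : 'I_N -> fps A) M n :
  (n < M)%N -> (\prod_(i < N) fps_trunc M (f i))`_n = (\prod_(i < N) f i) n.
Proof.
elim/big_rec2: _ n => [n _|i g p _ IHi n ltnM]; first by rewrite coef1.
by rewrite mulrC (coef_mul_fps_trunc IHi) // mulrC.
Qed.

Lemma coef_fps_prod (A : comNzRingType) N (f : 'I_N -> fps A) n :
  (\prod_(i < N) f i) n =
  \sum_(m : 'X_{1..N < n.+1} | mdeg m == n) \prod_(i < N) f i (m i).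
Proof.
rewrite -(@coef_fps_trunc_prod _ _ _ n.+1) //.
rewrite (eq_bigr _ (fun i _ => poly_def n.+1 (f i))) bigA_distr_bigA coef_sum /=.
pose exponents (m : 'X_{1..N < n.+1}) : {ffun 'I_N -> 'I_n.+1} := [ffun i => inord (m i)].
have exponentsE m i : exponents m i = m i :> nat.
  rewrite ffunE inordK //; apply: leq_ltn_trans (bmdeg m).
  by rewrite mdegE (bigD1 i) //= leq_addr.
rewrite (eq_bigr (fun g : {ffun 'I_N -> 'I_n.+1} =>
    if (\sum_(i < N) g i == n)%N then \prod_(i < N) f i (g i) else 0)) => [|g _]; last first.
  by rewrite scaler_prod -expr_sum coefZ coefXn eq_sym; case: eqP; rewrite ?mulr1 ?mulr0.
rewrite -big_mkcond (reindex_omap exponents (fun g => insub [multinom g i : nat | i < N])).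
  apply: eq_big => [m|m _]; last by apply: eq_bigr => i _; rewrite exponentsE.
  have -> : [multinom exponents m i : nat | i < N] = m.
    by apply/mnmP => i; rewrite mnmE; exact: exponentsE.
  by rewrite valK eqxx andbT mdegE (eq_bigr _ (fun i _ => exponentsE m i)).
move=> g /eqP sumg; have degg : (mdeg [multinom g i : nat | i < N] < n.+1)%N.
  by rewrite mdegE (eq_bigr (fun i => g i : nat)) ?sumg // => i _; rewrite mnmE.
rewrite insubT /=; congr Some; apply/ffunP => i.
by apply: ord_inj; rewrite (exponentsE (BMultinom degg)) mnmE.
Qed.

Section RSeries.
Variables (K : fieldType) (N : nat).
Implicit Types a b c : fps K.

Definition Rser a : fps {mpoly K[N]} := fun n => Rfun a n N.

Lemma Rser_prod a : Rser a = \prod_(i < N) fps_dil 'X_i (fps_map (@mpolyC N K) a).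
Proof. by []. Qed.

Lemma RserM a c : Rser (a * c) = Rser a * Rser c.
Proof. by rewrite !Rser_prod -big_split; apply: eq_bigr => i _; rewrite !rmorphM. Qed.

Lemma Rser1 : Rser 1 = 1.
Proof. by rewrite Rser_prod big1 // => i _; rewrite !rmorph1. Qed.

Lemma Rser_dil z a : Rser (fps_dil z a) = fps_dil z%:MP (Rser a).
Proof.
rewrite !Rser_prod rmorph_prod; apply: eq_bigr => i _.
by rewrite /= fps_map_dil !fps_dilA mulrC.
Qed.

Lemma mcoeff_Rfun a n (m : 'X_{1..N}) :
  (Rfun a n N)@_m = if mdeg m == n then \prod_i a (m i) else 0.
Proof.
pose c (g : 'X_{1..N}) := if mdeg g == n then \prod_i a (g i) else 0.
have -> : Rfun a n N = \sum_(g : 'X_{1..N < n.+1}) c g *: 'X_[g].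
  rewrite -[LHS]/(Rser a n) Rser_prod coef_fps_prod big_mkcond; apply: eq_bigr => g _.
  rewrite /c; case: ifP => _; last by rewrite scale0r.
  by rewrite big_split /= -rmorph_prod -mpolyXE_id mulrC mul_mpolyC.
have [/mcoeff_mpoly-> //|ltn_deg] := ltnP (mdeg m) n.+1.
rewrite gtn_eqF // raddf_sum big1 // => g _.
rewrite /= mcoeffZ mcoeffX; case: (g =P m :> 'X_{1..N}) => [gm|_]; last by rewrite mulr0.
by have := bmdeg g; rewrite gm ltnNge ltn_deg.
Qed.

Lemma coef0_Rser a : a 0%N = 1 -> Rser a 0%N = 1.
Proof.
move=> a0; apply/mpolyP=> m.
rewrite mcoeff_Rfun mcoeff1 mdeg_eq0; case: eqP => // ->.
by rewrite big1 // => i _; rewrite mnmE.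
Qed.

Lemma Rser_inv a : a 0%N = 1 -> Rser (fps_inv a) = fps_inv (Rser a).
Proof.
by move=> a0; apply: fps_inv_unique; rewrite ?coef0_Rser // -RserM fps_mulV // Rser1.
Qed.

Lemma hsym_Rser n : hsym K n N = Rser (fps_geom K) n.
Proof.
rewrite Rser_prod coef_fps_prod; apply: eq_bigr => m _.
by rewrite mpolyXE_id; apply: eq_bigr => i _; rewrite /fps_dil /fps_map mpolyC1 mulr1.
Qed.

Lemma mesym_Rser n : mesym N K n = Rser (fps_1addX K) n.
Proof.
apply/mpolyP => m; rewrite mcoeff_mesym mcoeff_Rfun /mechar; case: eqP => //= _.
case: (boolP [forall i, (m i <= 1)%N]) => [/forallP le1|].
  by rewrite big1 // => i _; rewrite /fps_1addX le1.
rewrite negb_forall => /existsP[i /negPf gt1].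
by rewrite (bigD1 i) //= /fps_1addX gt1 mul0r.
Qed.

Definition hser : fps {mpoly K[N]} := fun n => hsym K n N.
Definition eser : fps {mpoly K[N]} := fun n => mesym N K n.

Lemma hser_Rser : hser = Rser (fps_geom K).
Proof. by apply/fps_ext => n; apply: hsym_Rser. Qed.

Lemma coef0_hser : hser 0%N = 1.
Proof. by rewrite hser_Rser coef0_Rser. Qed.

Lemma eser_hser : eser = fps_inv (fps_dil (-1) hser).
Proof.
have <- : (-1)%:MP = -1 :> {mpoly K[N]} by rewrite mpolyCN mpolyC1.
rewrite hser_Rser -Rser_dil -Rser_inv ?coef0_fps_dil // fps_inv_dil_geom.
by apply/fps_ext => n; apply: mesym_Rser.
Qed.

Definition psym k : {mpoly K[N]} := \sum_(i < N) 'X_i ^+ k.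

Lemma psym_sym k : psym k \is symmetric.
Proof.
apply/issymP=> s; rewrite /psym [LHS]rmorph_sum /= [RHS](reindex_inj (@perm_inj _ s)).
by apply: eq_bigr => i _; rewrite rmorphXn /= /msym mmapX mmap1U.
Qed.

Lemma fps_logder_Rser a b : fps_logder a b ->
  fps_logder (Rser a) (fun k => b k *: psym k).
Proof.
move=> ab; have -> : (fun k => b k *: psym k) =
    \sum_(i < N) fps_dil 'X_i (fps_map (@mpolyC N K) b).
  apply/fps_ext => k; rewrite coef_fps_sum scaler_sumr; apply: eq_bigr => i _.
  by rewrite /fps_dil mulrC mul_mpolyC.
rewrite Rser_prod; elim/big_rec2: _ => [|i c f _ IHi]; first exact: fps_logder1.
by apply: fps_logderM IHi; apply/fps_logder_dil/fps_logder_map.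
Qed.

End RSeries.

Lemma eval_ones_Rfun (K : fieldType) (a : fps K) k n :
  eval_ones k (Rfun a n) = fps_pow a k n.
Proof.
rewrite fps_powE -[eval_ones k _]/(fps_map (meval (fun=> 1)) (Rser k a) n).
rewrite Rser_prod rmorph_prod /= (eq_bigr (fun=> a)) ?prodr_const ?card_ord // => i _.
rewrite fps_map_dil /= mevalXU fps_dil1; apply/fps_ext => m; exact: mevalC.
Qed.

Section HomogeneousSymmetricFunctions.
Variable K : fieldType.
Implicit Types f g : varfam K.

Definition mnm_ext N (m : 'X_{1..N}) : 'X_{1..N.+1} :=
  [multinom oapp m 0%N (unlift ord_max i) | i < N.+1].

Lemma mnm_ext_lift N (m : 'X_{1..N}) i : mnm_ext m (lift ord_max i) = m i.
Proof. by rewrite mnmE liftK. Qed.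

Lemma mnm_ext_max N (m : 'X_{1..N}) : mnm_ext m ord_max = 0%N.
Proof. by rewrite mnmE unlift_none. Qed.

Lemma mdeg_mnm_ext N (m : 'X_{1..N}) : mdeg (mnm_ext m) = mdeg m.
Proof.
rewrite !mdegE (bigD1_ord ord_max) //= mnm_ext_max add0n.
by apply: eq_bigr => i _; rewrite mnm_ext_lift.
Qed.

Lemma mcoeff_drop_last_var N (p : {mpoly K[N.+1]}) m :
  (drop_last_var p)@_m = p@_(mnm_ext m).
Proof.
rewrite {2}[p]mpolyE /drop_last_var comp_mpolyEX !raddf_sum; apply: eq_bigr => m' _.
rewrite /= !mcoeffZ mcoeffX comp_mpolyX; congr (_ * _).
rewrite (bigD1_ord ord_max) //= tnth_mktuple unlift_none /=.
under eq_bigr do rewrite tnth_mktuple liftK /=.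
rewrite (_ : \prod_(i < N) _ = 'X_[[multinom m' (lift ord_max i) | i < N]]); last first.
  by rewrite [RHS]mpolyXE_id; apply: eq_bigr => i _; rewrite mnmE.
case: (posnP (m' ord_max)) => [m'0|m'gt0]; last first.
  rewrite expr0n gtn_eqF // mul0r mcoeff0; case: eqP => // m'E.
  by move: m'gt0; rewrite m'E mnm_ext_max.
rewrite m'0 expr0 mul1r mcoeffX; congr (_ : bool)%:R; apply/eqP/eqP => [<-|->].
  apply/mnmP=> i; case: (unliftP ord_max i) => [j ->|->]; last by rewrite mnm_ext_max.
  by rewrite mnm_ext_lift mnmE.
by apply/mnmP=> i; rewrite mnmE mnm_ext_lift.
Qed.

Lemma homog_symfun_Rfun (a : fps K) n : a 0%N = 1 -> homog_symfun n (Rfun a n).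
Proof.
move=> a0; split=> N.
- apply/issymP=> s; apply/mpolyP=> m; rewrite mcoeff_sym !mcoeff_Rfun mdeg_mperm.
  case: eqP => // _; rewrite [RHS](reindex_inj (@perm_inj _ s)).
  by apply: eq_bigr => i _; rewrite mnmE.
- apply/dhomogP=> m; rewrite mcoeff_msupp mcoeff_Rfun.
  by case: (mdeg m =P n) => [degm _ //|_]; rewrite eqxx.
apply/mpolyP=> m; rewrite mcoeff_drop_last_var !mcoeff_Rfun mdeg_mnm_ext.
rewrite (bigD1_ord ord_max) //= mnm_ext_max a0 mul1r; case: ifP => // _.
by apply: eq_bigr => i _; rewrite mnm_ext_lift.
Qed.

Lemma homog_symfun_lincomb n (I : eqType) (r : seq I) (c : I -> K) (B : I -> varfam K) :
    {in r, forall i, homog_symfun n (B i)} ->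
  homog_symfun n (fun N => \sum_(i <- r) c i *: B i N).
Proof.
move=> homB; split=> N.
- by rewrite big_seq; apply: rpred_sum => i /homB[symB _ _]; apply/rpredZ/symB.
- by rewrite big_seq; apply: rpred_sum => i /homB[_ degB _]; apply/rpredZ/degB.
rewrite /drop_last_var raddf_sum /= big_seq [RHS]big_seq.
by apply: eq_bigr => i /homB[_ _ dropB]; rewrite linearZ -(dropB N).
Qed.

Lemma homog_symfunM m n f g : homog_symfun m f -> homog_symfun n g ->
  homog_symfun (m + n) (fun N => f N * g N).
Proof.
move=> [symf degf dropf] [symg degg dropg]; split=> N.
- exact/rpredM/symg/symf.
- exact: dhomogM (degf N) (degg N).
by rewrite -(dropf N) -(dropg N) /drop_last_var rmorphM.
Qed.

Lemma homog_symfun_hfun l : homog_symfun (sumn l) (hfun K l).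
Proof.
elim: l => [|k l IHl].
  have -> : hfun K [::] = fun N => 1.
    by apply: functional_extensionality_dep => N; apply: big_nil.
  by split=> N; rewrite ?rpred1 ?dhomog1 // /drop_last_var rmorph1.
have -> : hfun K (k :: l) = fun N => Rfun (fps_geom K) k N * hfun K l N.
  by apply: functional_extensionality_dep => N; rewrite /hfun big_cons hsym_Rser.
exact/homog_symfunM/IHl/homog_symfun_Rfun.
Qed.

(* By symmetry the missing variable may be taken to be the last one. *)
Lemma mcoeff_homog_symfunS n f N (m : 'X_{1..N.+1}) i :
    homog_symfun n f -> m i = 0%N ->
  (f N.+1)@_m = (f N)@_[multinom m (tperm i ord_max (lift ord_max j)) | j < N].
Proof.
move=> [symf _ dropf] mi0; rewrite -(msym_coeff m (tperm i ord_max) (symf _)) -(dropf N).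
rewrite mcoeff_drop_last_var; congr (_@__); apply/mnmP => j.
case: (unliftP ord_max j) => [k ->|->]; first by rewrite mnm_ext_lift !mnmE.
by rewrite mnm_ext_max mnmE tpermR.
Qed.

Lemma homog_symfun_eq n f g :
  homog_symfun n f -> homog_symfun n g -> f n = g n -> forall N, f N = g N.
Proof.
move=> homf homg fgn N; case: (homf) (homg) => [_ degf dropf] [_ degg dropg].
have eq_below d M : f (M + d)%N = g (M + d)%N -> f M = g M.
  elim: d => [|d IHd]; first by rewrite addn0.
  by rewrite addnS => eqS; apply: IHd; rewrite -dropf -dropg eqS.
have [leNn|/ltnW/subnKC <-] := leqP N n; first by apply: (eq_below (n - N)%N); rewrite subnKC.
elim: (N - n)%N => [|d IHd]; first by rewrite addn0.
rewrite addnS; apply/mpolyP => m; have [degm|degm] := eqVneq (mdeg m) n; last first.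
  by rewrite !(dhomog_nemf_coeff (_ : _ \is n.-homog) degm).
have [i /eqP mi0] : exists i, m i == 0%N.
  apply/existsP; apply: contraT; rewrite negb_exists => /forallP mgt0.
  suff: ((n + d).+1 <= mdeg m)%N by rewrite degm ltnNge leq_addr.
  rewrite mdegE -[X in (X <= _)%N]card_ord -sum1_card leq_sum // => j _.
  by rewrite lt0n.
by rewrite (mcoeff_homog_symfunS homf mi0) (mcoeff_homog_symfunS homg mi0) IHd.
Qed.

Lemma is_expansion_at_degree (B : seq nat -> varfam K) n f c :
    {in partns n, forall l, homog_symfun n (B l)} -> homog_symfun n f ->
  f n = \sum_(l <- partns n) c l *: B l n -> is_expansion B n f c.
Proof. by move=> homB homf; apply/homog_symfun_eq/homog_symfun_lincomb. Qed.

Lemma bcoef_expansion (B : seq nat -> varfam K) n f :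
  (exists c, is_expansion B n f c) -> is_expansion B n f (bcoef B n f).
Proof. exact: epsilon_spec. Qed.

End HomogeneousSymmetricFunctions.

(** * Expansions in complete homogeneous symmetric functions *)

Lemma mpoly_rmorph_ext n (R S : comNzRingType) (phi psi : {rmorphism {mpoly R[n]} -> S}) :
    (forall c, phi c%:MP = psi c%:MP) -> (forall i, phi 'X_i = psi 'X_i) ->
  phi =1 psi.
Proof.
move=> eqC eqX p; rewrite (mpolyE p) !rmorph_sum; apply: eq_bigr => m _.
rewrite -mul_mpolyC !rmorphM eqC mpolyXE_id !rmorph_prod; congr (_ * _).
by apply: eq_bigr => i _; rewrite !rmorphXn eqX.
Qed.

Section GenericSeries.
Variables (R : comNzRingType) (N : nat).

(* 1 + X_1 t + ... + X_N t^N *)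
Definition varser : fps {mpoly R[N]} :=
  fun n => if n is n'.+1 then oapp (fun i : 'I_N => 'X_i) 0 (insub n') else 1.

Definition coef_tuple (f : fps {mpoly R[N]}) : N.-tuple {mpoly R[N]} :=
  [tuple f i.+1 | i < N].

Lemma varserS (i : 'I_N) : varser i.+1 = 'X_i.
Proof. by rewrite /varser valK. Qed.

Lemma comp_mpolyXU_coef_tuple f i : 'X_i \mPo coef_tuple f = f i.+1.
Proof. by rewrite comp_mpolyXU -tnth_nth tnth_mktuple. Qed.

Lemma fps_agree_map_varser (S : comNzRingType) (psi : {rmorphism {mpoly R[N]} -> S}) f :
    f 0%N = 1 -> (forall i : 'I_N, psi 'X_i = f i.+1) ->
  fps_agree N (fps_map psi varser) f.
Proof.
move=> f0 psiX [_|n ltnN]; first by rewrite f0 [LHS]rmorph1.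
by rewrite -(psiX (Ordinal ltnN)) -varserS.
Qed.

Definition omegaser : fps {mpoly R[N]} := fps_inv (fps_dil (-1) varser).

Lemma map_omegaser (S : comNzRingType) (psi : {rmorphism {mpoly R[N]} -> S}) f (i : 'I_N) :
    f 0%N = 1 -> (forall i : 'I_N, psi 'X_i = f i.+1) ->
  psi (omegaser i.+1) = fps_inv (fps_dil (-1) f) i.+1.
Proof.
move=> f0 psiX; rewrite -[LHS]/(fps_map psi omegaser i.+1) fps_map_inv ?coef0_fps_dil //.
rewrite fps_map_dil rmorphN1; apply: (@fps_agree_inv _ N) => //.
  by rewrite coef0_fps_dil [LHS]rmorph1.
exact/fps_agree_dil/fps_agree_map_varser.
Qed.

Lemma comp_omegaserK (p : {mpoly R[N]}) :
  (p \mPo coef_tuple omegaser) \mPo coef_tuple omegaser = p.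
Proof.
rewrite -[RHS]comp_mpoly_id.
apply: (@mpoly_rmorph_ext _ _ _ (comp_mpoly _ \o comp_mpoly _) (comp_mpoly _)) => [c|i] /=.
  by rewrite !comp_mpolyC.
rewrite comp_mpolyXU_coef_tuple (@map_omegaser _ _ omegaser) => [||j].
- rewrite -fps_inv_dil ?coef0_fps_dil // fps_dilA mulrNN mulr1 fps_dil1 fps_invK // varserS.
  by rewrite comp_mpolyXU -tnth_nth tnth_mktuple.
- exact: coef0_fps_inv.
exact: comp_mpolyXU_coef_tuple.
Qed.

End GenericSeries.

Local Notation hcomp p := (p \mPo coef_tuple (hser _ _)).

Section HFundamental.
Variables (K : fieldType) (N : nat).
Implicit Types p q : {mpoly K[N]}.

Local Notation ecomp p := (p \mPo coef_tuple (eser K N)).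
Local Notation omega p := (p \mPo coef_tuple (omegaser K N)).

(* The substitution exchanging h_1, ..., h_N with e_1, ..., e_N is an involution, so
   that the fundamental theorem holds for the former as it does for the latter. *)
Lemma hcomp_omega p : hcomp (omega p) = ecomp p.
Proof.
apply: (@mpoly_rmorph_ext _ _ _ (comp_mpoly _ \o comp_mpoly _) (comp_mpoly _)) => [c|i] /=.
  by rewrite !comp_mpolyC.
rewrite !comp_mpolyXU_coef_tuple eser_hser; apply: map_omegaser; first exact: coef0_hser.
exact: comp_mpolyXU_coef_tuple.
Qed.

Lemma hcomp_inj p q : hcomp p = hcomp q -> p = q.
Proof.
rewrite -(comp_omegaserK p) -(comp_omegaserK q) !hcomp_omega.
by move=> /msym_fundamental_un->.
Qed.

Definition hpoly p : {mpoly K[N]} := omega (symf p).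

Lemma hpolyK p : p \is symmetric -> hcomp (hpoly p) = p.
Proof. by move=> symp; rewrite hcomp_omega [RHS]symfP. Qed.

Lemma hcomp_varser k : (k <= N)%N -> hcomp (varser K N k) = hser K N k.
Proof.
apply: fps_agree_map_varser; first exact: coef0_hser.
exact: comp_mpolyXU_coef_tuple.
Qed.

End HFundamental.

Lemma leq_sumn_mem k l : k \in l -> (k <= sumn l)%N.
Proof. by move=> kl; rewrite sumnE (perm_big _ (perm_to_rem kl)) big_cons leq_addr. Qed.

Section HExpansion.
Variable K : fieldType.

Lemma hfun_perm l l' N : perm_eq l l' -> hfun K l N = hfun K l' N.
Proof. exact: perm_big. Qed.

Definition mnm_parts N (m : 'X_{1..N}) : seq nat :=
  sort geq (flatten [seq nseq (m i) i.+1 | i <- enum 'I_N]).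

Lemma is_partn_mnm_parts N (m : 'X_{1..N}) : is_partn (mnmwgt m) (mnm_parts m).
Proof.
apply/and3P; split.
- by apply: sort_sorted => i j; apply: leq_total.
- rewrite mem_sort; apply/flattenP => -[s /mapP[i _ ->]].
  by rewrite mem_nseq andbF.
rewrite (perm_sumn (permEl (perm_sort _ _))) sumn_flatten -map_comp sumnE big_map.
by rewrite big_enum; apply/eqP/eq_bigr => i _; rewrite /= sumn_nseq mulnC.
Qed.

Lemma hcomp_mnm N (m : 'X_{1..N}) : hcomp 'X_[m] = hfun K (mnm_parts m) N.
Proof.
rewrite (hfun_perm N (permEl (perm_sort _ _))) /hfun big_flatten big_map big_enum.
rewrite comp_mpolyX; apply: eq_bigr => i _.
by rewrite big_nseq tnth_mktuple /hser; elim: (m i) => // d IHd; rewrite exprS IHd.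
Qed.

Lemma hfun_expansion n (f : varfam K) :
  homog_symfun n f -> exists c, is_expansion (@hfun K) n f c.
Proof.
move=> homf; have [symf degf _] := homf; pose t := hpoly (f n).
exists (fun l => \sum_(m <- msupp t | mnm_parts m == l) t@_m).
apply: is_expansion_at_degree (homf) _ => [l|].
  by rewrite mem_partns => /and3P[_ _ /eqP <-]; apply: homog_symfun_hfun.
transitivity (\sum_(m <- msupp t) t@_m *: pihomog mdeg n (hfun K (mnm_parts m) n)).
  rewrite -[LHS](pihomog_dE (degf n)) -[X in pihomog _ _ X]hpolyK // comp_mpolyEX linear_sum.
  by apply: eq_bigr => m _; rewrite linearZ /= hcomp_mnm.
under [RHS]eq_bigr do rewrite scaler_suml big_mkcond.
rewrite [RHS]exchange_big; apply: eq_bigr => m _ /=.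
have [_ degm _] := homog_symfun_hfun K (mnm_parts m).
have /and3P[sorted_m m0 _] := is_partn_mnm_parts m.
case: (boolP (mnm_parts m \in partns n)) => [mn|mn]; last first.
  rewrite big_seq big1 => [|l ln]; last by case: eqP mn => // ->; rewrite ln.
  rewrite (pihomog_ne0 _ (degm n)) ?scaler0 //.
  by apply: contra mn => sum_m; rewrite mem_partns; apply/and3P.
rewrite (bigD1_seq _ mn) ?partns_uniq //= eqxx big1 ?addr0 => [|l /negPf lm].
  move: mn; rewrite mem_partns => /and3P[_ _ /eqP sum_m].
  by have := degm n; rewrite sum_m => /pihomog_dE->.
by rewrite eq_sym lm.
Qed.

Lemma hpoly_expansion n (f : varfam K) : homog_symfun n f ->
  hpoly (f n) = \sum_(l <- partns n) bcoef (@hfun K) n f l *: \prod_(k <- l) varser K n k.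
Proof.
move=> homf; have [symf _ _] := homf; apply: hcomp_inj; rewrite hpolyK //.
rewrite [LHS](bcoef_expansion (hfun_expansion homf)) linear_sum /=.
rewrite big_seq [RHS]big_seq; apply: eq_bigr => l; rewrite mem_partns => /and3P[_ _ /eqP suml].
rewrite comp_mpolyZ rmorph_prod /hfun; congr (_ *: _).
rewrite big_seq [RHS]big_seq; apply: eq_bigr => k /leq_sumn_mem le_kl.
by rewrite /= hcomp_varser // -suml.
Qed.

End HExpansion.

Section HSpecialization.
Variables (K : fieldType) (n : nat).
Implicit Types c d : fps K.

(* R_k as a polynomial in h_1, ..., h_n. *)
Definition hRser c : fps {mpoly K[n]} := fun k => hpoly (Rser n c k).

Lemma hcomp_hRser c k :
  c 0%N = 1 -> hcomp (hRser c k) = Rser n c k.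
Proof.
move=> c0; apply: hpolyK.
by have [symR _ _] := homog_symfun_Rfun k c0; apply: symR.
Qed.

Lemma coef0_hRser c : c 0%N = 1 -> hRser c 0%N = 1.
Proof.
by move=> c0; apply: hcomp_inj; rewrite hcomp_hRser // comp_mpoly1 coef0_Rser.
Qed.

Lemma hRser_geom : fps_agree n (hRser (fps_geom K)) (varser K n).
Proof.
by move=> k lekn; apply: hcomp_inj; rewrite hcomp_hRser // hcomp_varser // hser_Rser.
Qed.

Lemma fps_logder_hRser c d : c 0%N = 1 -> fps_logder c d ->
  fps_logder (hRser c) (fun k => d k *: hpoly (psym K n k)).
Proof.
move=> c0 cd; pose hmap := fps_map (comp_mpoly (coef_tuple (hser K n))).
have hmap_R : hmap (hRser c) = Rser n c by apply/fps_ext => k; apply: hcomp_hRser.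
have hmap_p : hmap (fun k => d k *: hpoly (psym K n k)) = (fun k => d k *: psym K n k).
  by apply/fps_ext => k; rewrite /hmap /fps_map linearZ /= hpolyK ?psym_sym.
apply/fps_ext => k; apply: hcomp_inj.
have := fps_logder_Rser n cd; rewrite -hmap_R -hmap_p /fps_logder fps_theta_map -rmorphM.
by move=> /(congr1 (fun f => f k)).
Qed.

End HSpecialization.

(* A ring morphism sending each h_k to eta_k sends the power sum p_k to pi_k, hence R_n
   to rho_n. *)
Lemma Rfun_specialization (K : fieldType) (L : comNzRingType) (phi : {rmorphism K -> L})
    (a b : fps K) (eta pi rho : fps L) n :
    [pchar K] =i pred0 -> a 0%N = 1 -> fps_logder a b ->
    eta 0%N = 1 -> fps_logder eta pi ->
    rho 0%N = 1 -> fps_logder rho (fun k => phi (b k) * pi k) ->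
  \sum_(l <- partns n) phi (bcoef (@hfun K) n (Rfun a n) l) * \prod_(k <- l) eta k = rho n.
Proof.
move=> charK0 a0 logder_a eta0 logder_eta rho0 logder_rho.
pose psi : {rmorphism {mpoly K[n]} -> L} := mmap phi (fun i : 'I_n => eta i.+1).
have psiZ c p : psi (c *: p) = phi c * psi p by apply: mmapZ.
have psi_varser k : (k <= n)%N -> psi (varser K n k) = eta k.
  by apply: fps_agree_map_varser => // i; rewrite /psi /= mmapX mmap1U.
have psi_hR c d : c 0%N = 1 -> fps_logder c d -> fps_map psi (hRser n c) 0%N = 1 /\
    fps_logder (fps_map psi (hRser n c)) (fun k => phi (d k) * psi (hpoly (psym K n k))).
  move=> c0 cd; rewrite /fps_map coef0_hRser // rmorph1; split=> //.
  have := fps_logder_map psi (fps_logder_hRser n c0 cd).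
  by congr fps_logder; apply/fps_ext => k; rewrite -psiZ.
have [geom0 logder_geom] := psi_hR _ _ erefl (fps_logder_geom K).
have psi_psym k : (k < n)%N -> psi (hpoly (psym K n k.+1)) = pi k.+1.
  move=> ltkn; rewrite -(fps_agree_logder geom0 logder_geom logder_eta (M := n)) //.
    by rewrite coef_fpsD coef_fpsN subr0 rmorph1 mul1r.
  by move=> i lein; rewrite /fps_map hRser_geom ?psi_varser.
have [R0 logder_R] := psi_hR _ _ a0 logder_a.
rewrite -(fps_agree_of_logder (natrS_lreg charK0 phi) R0 rho0 logder_R logder_rho (M := n)) //.
  rewrite /fps_map /hRser (hpoly_expansion (homog_symfun_Rfun n a0)) rmorph_sum.
  rewrite big_seq [RHS]big_seq; apply: eq_bigr => l.
  rewrite mem_partns => /and3P[_ _ /eqP suml].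
  rewrite psiZ rmorph_prod; congr (_ * _).
  rewrite big_seq [RHS]big_seq; apply: eq_bigr => k /leq_sumn_mem le_kl.
  by rewrite /= psi_varser // -suml.
move=> [_|k ltkn]; last by rewrite psi_psym.
by rewrite (fps_logder_coef0 logder_a a0) rmorph0 !mul0r.
Qed.

Lemma prod_natb (T : Type) (R : comNzRingType) (P : pred T) (s : seq T) :
  \prod_(x <- s) (P x)%:R = (all P s)%:R :> R.
Proof.
by elim: s => [|x s IHs]; rewrite ?big_nil // big_cons IHs -natrM mulnb.
Qed.

Lemma mem_partns_nseq n k : (0 < k)%N -> nseq n k \in partns (k * n).
Proof.
move=> k0; rewrite mem_partns /is_partn sumn_nseq eqxx andbT mem_nseq (ltn_eqF k0) andbF andbT.
by elim: n => [|[|n] IHn] //=; rewrite /geq /= leqnn.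
Qed.

Lemma all_pred1_partn n k l : (0 < k)%N ->
  l \in partns (k * n) -> all (pred1 k) l = (l == nseq n k).
Proof.
move=> k0; rewrite mem_partns => /and3P[_ _ /eqP suml].
apply/idP/eqP => [/all_pred1P lE|->]; last by rewrite all_nseq /= eqxx orbT.
by move: suml; rewrite lE sumn_nseq => /eqP; rewrite eqn_pmul2l // => /eqP->.
Qed.

Lemma fps_expand_1addX (A : comNzRingType) k j : (0 < k)%N -> (0 < j)%N ->
  fps_expand k (fps_1addX A) j = (j == k)%:R.
Proof.
move=> k0 j0; rewrite /fps_expand /fps_1addX; case: (boolP (k %| j)%N) => [/dvdnP[d jE]|kj].
  by rewrite jE mulnK // -{2}[k]mul1n eqn_pmul2r //; case: d jE j0 => [-> //|[|d]].
by case: eqP kj => // ->; rewrite dvdnn.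
Qed.

Lemma prod_fps_expand_1addX (A : comNzRingType) k n l : (0 < k)%N -> l \in partns (k * n) ->
  \prod_(j <- l) fps_expand k (fps_1addX A) j = (l == nseq n k)%:R.
Proof.
move=> k0 ln; rewrite -(all_pred1_partn k0 ln) -prod_natb big_seq [RHS]big_seq.
apply: eq_bigr => j jl; apply: fps_expand_1addX => //.
by move: ln; rewrite mem_partns lt0n => /and3P[_ /memPn/(_ _ jl)].
Qed.

Section QuadraticSpecialization.
Variable K : fieldType.
Implicit Types b q : fps K.

Definition fps_hadamard (f g : fps K) : fps K := fun n => f n * g n.

Definition xcoef s (f : fps {poly K}) : fps K := fun n => (f n)`_s.

Lemma xcoefM s f g : xcoef s (f * g) = \sum_(i < s.+1) xcoef i f * xcoef (s - i) g.
Proof.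
apply/fps_ext => n; rewrite /xcoef coef_fps_sum coef_fpsM coef_sum.
under eq_bigr do rewrite coefM.
by rewrite exchange_big.
Qed.

Lemma xcoef_theta s f : xcoef s (fps_theta f) = fps_theta (xcoef s f).
Proof. by apply/fps_ext => n; rewrite /xcoef /fps_theta mulr_natl coefMn mulr_natl. Qed.

Lemma xcoef_hadamard s f c :
  xcoef s (fun k => (c k)%:P * f k) = fps_hadamard c (xcoef s f).
Proof. by apply/fps_ext => n; rewrite /xcoef mul_polyC coefZ. Qed.

Lemma fps_hadamard_is_zmod_morphism f : zmod_morphism (fps_hadamard f).
Proof. by move=> g h; apply/fps_ext => n; apply: mulrBr. Qed.

HB.instance Definition _ f := GRing.isZmodMorphism.Build (fps K) (fps K)
  (fps_hadamard f) (fps_hadamard_is_zmod_morphism f).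

Lemma theta_hadamard f g : fps_theta (fps_hadamard f g) = fps_hadamard f (fps_theta g).
Proof. by apply/fps_ext => n; apply: mulrCA. Qed.

(* 1 + X q(t) *)
Definition linser (q : fps K) : fps {poly K} := fun n => (n == 0%N)%:R + q n *: 'X.

Lemma xcoef_linser q :
  [/\ xcoef 0 (linser q) = 1, xcoef 1 (linser q) = q & xcoef 2 (linser q) = 0].
Proof.
split; apply/fps_ext => n; rewrite /xcoef /linser coefD coefZ coefX -polyC_natr coefC /=.
- by rewrite mulr0 addr0.
- by rewrite mulr1 add0r.
by rewrite mulr0 add0r.
Qed.

Lemma xcoef_logder_linser q pi : fps_logder (linser q) pi ->
  [/\ xcoef 0 pi = 0, xcoef 1 pi = fps_theta q & xcoef 2 pi = - fps_theta q * q].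
Proof.
move=> eta_pi; have [eta_0 eta_1 eta_2] := xcoef_linser q.
have logder_s s := congr1 (xcoef s) eta_pi.
have pi_0 : xcoef 0 pi = 0.
  by have := logder_s 0%N; rewrite xcoef_theta xcoefM big_ord1 eta_0 fps_theta1 mulr1.
have pi_1 : xcoef 1 pi = fps_theta q.
  have := logder_s 1%N; rewrite xcoef_theta xcoefM !big_ord_recl big_ord0 /=.
  by rewrite eta_0 eta_1 pi_0 mul0r mulr1 add0r addr0.
split=> //; have := logder_s 2%N; rewrite xcoef_theta xcoefM !big_ord_recl big_ord0 /=.
rewrite eta_0 eta_1 eta_2 pi_0 pi_1 raddf0 mul0r add0r addr0 mulr1 => /esym/eqP.
by rewrite addrC addr_eq0 mulNr => /eqP.
Qed.

Lemma xcoef2_specialization b q pi rho : [pchar K] =i pred0 -> b 0%N = 0 ->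
    fps_logder (linser q) pi -> rho 0%N = 1 ->
    fps_logder rho (fun k => (b k)%:P * pi k) ->
  2%:R * xcoef 2 rho = fps_hadamard b q ^+ 2 - fps_hadamard b (q ^+ 2).
Proof.
move=> charK0 b0 /xcoef_logder_linser[pi_0 pi_1 pi_2] rho0 rho_bpi.
have rho0_s s : xcoef s rho 0%N = (s == 0%N)%:R by rewrite /xcoef rho0 coef1.
have logder_s s := congr1 (xcoef s) rho_bpi.
have rho_0 : xcoef 0 rho = 1.
  apply: (fps_theta_inj charK0); last exact: rho0_s.
  have := logder_s 0%N; rewrite xcoef_theta xcoefM big_ord1 xcoef_hadamard pi_0.
  by rewrite raddf0 mul0r fps_theta1.
have rho_1 : xcoef 1 rho = fps_hadamard b q.
  apply: (fps_theta_inj charK0); last by rewrite rho0_s /fps_hadamard b0 mul0r.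
  have := logder_s 1%N; rewrite xcoef_theta xcoefM !big_ord_recl big_ord0 /=.
  by rewrite !xcoef_hadamard pi_0 pi_1 rho_0 raddf0 mul0r add0r addr0 mulr1 theta_hadamard.
have theta_rho_2 : fps_theta (xcoef 2 rho) =
    fps_theta (fps_hadamard b q) * fps_hadamard b q - fps_hadamard b (fps_theta q * q).
  have := logder_s 2%N; rewrite xcoef_theta xcoefM !big_ord_recl big_ord0 /=.
  rewrite !xcoef_hadamard pi_0 pi_1 pi_2 rho_0 rho_1 raddf0 mul0r add0r addr0 mulr1.
  by rewrite theta_hadamard mulNr raddfN.
apply: (fps_theta_inj charK0); last first.
  rewrite coef_fpsD coef_fpsN expr2 !coef0_fpsM rho0_s /fps_hadamard b0.
  by rewrite !mul0r mulr0 subr0.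
rewrite mulr_natl raddfMn raddfB /= theta_rho_2 !expr2 fps_thetaM !theta_hadamard.
by rewrite fps_thetaM [q * _]mulrC raddfD /=; ring.
Qed.

Lemma coef_prod_linser q l : 0%N \notin l ->
  (\prod_(k <- l) linser q k)`_2 = (\prod_(k <- l) q k) *+ (size l == 2%N).
Proof.
move=> l0; have -> : \prod_(k <- l) linser q k = (\prod_(k <- l) q k) *: 'X^(size l).
  elim: l l0 => [|k l IHl]; first by rewrite !big_nil scale1r.
  rewrite inE negb_or eq_sym => /andP[/negPf k0 /IHl {}IHl]; rewrite !big_cons IHl.
  by rewrite /linser k0 add0r -scalerAl -scalerAr scalerA exprS.
by rewrite coefZ coefXn eq_sym mulr_natr.
Qed.

Lemma partn_pair i j l : l \in partns (i + j) ->
  all (pred2 i j) l && (size l == 2%N) = (l == [:: maxn i j; minn i j]).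
Proof.
rewrite mem_partns => /and3P[sortl l0 suml].
case: l sortl l0 suml => [|x [|y [|z l]]]; rewrite ?andbF ?eqseq_cons ?andbF //=.
rewrite /geq /= addn0 !andbT => leyx _ sumxy; lia.
Qed.

(* t^i + t^j if i and j differ, else t^i *)
Definition pairser i j : fps K := fun k => (pred2 i j k)%:R.

Lemma quadratic_coef_pairser b i j :
  (fps_hadamard b (pairser i j) ^+ 2 - fps_hadamard b (pairser i j ^+ 2)) (i + j)%N =
  (b i * b j - b (i + j)%N) *+ (i != j).+1.
Proof.
have lti : (i < (i + j).+1)%N by rewrite ltnS leq_addr.
have ltj : (j < (i + j).+1)%N by rewrite ltnS leq_addl.
rewrite coef_fpsD coef_fpsN /fps_hadamard !expr2 !coef_fpsM mulr_sumr -sumrB.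
rewrite (_ : (i != j) = (Ordinal lti != Ordinal ltj)) // -card2 -sumr_const [RHS]big_mkcond.
apply: eq_bigr => u _; rewrite /pairser !inE -!val_eqE /=.
have -> : ((i + j - u == i)%N || (i + j - u == j)%N) = ((u == i :> nat) || (u == j :> nat)).
  by have := ltn_ord u; lia.
case: (_ =P i) => [->|_] /=; first by rewrite addKn !mulr1.
case: (_ =P j) => [->|_] /=; last by rewrite !(mulr0, mul0r) subr0.
by rewrite addnK !mulr1 [b j * _]mulrC.
Qed.

Lemma coef_prod_pairser i j l : l \in partns (i + j) ->
  (\prod_(k <- l) linser (pairser i j) k)`_2 = (l == [:: maxn i j; minn i j])%:R.
Proof.
move=> ln; rewrite coef_prod_linser; last by move: ln; rewrite mem_partns => /and3P[].
by rewrite prod_natb -(partn_pair ln) -mulnb natrM mulr_natr.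
Qed.

End QuadraticSpecialization.

Section HCoefficients.
Variables (K : fieldType) (a b : fps K).
Hypothesis charK0 : [pchar K] =i pred0.
Hypotheses (a0 : a 0%N = 1) (log_a : fps_log a = fps_logser b).

Let logder_a : fps_logder a (fps_theta (fps_logser b)).
Proof. by rewrite -log_a; apply: fps_logder_log. Qed.

Lemma theta_logser n : (0 < n)%N -> fps_theta (fps_logser b) n = b n.
Proof. by case: n => // n _; rewrite /fps_theta /= mulrC divfK ?natrS_neq0. Qed.

Lemma fps_logder_expand_exp k (g := - fps_dil (-1) (fps_logser (fun i => b (k * i)%N))) :
    (0 < k)%N ->
  fps_logder (fps_expand k (fps_exp g)) (fun m => fps_theta (fps_logser b) m *
    fps_expand k (k%:R * - fps_dil (-1) (fps_geom K - 1)) m).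
Proof.
move=> k0; have g0 : g 0%N = 0 by rewrite /g coef_fpsN coef0_fps_dil oppr0.
have := fps_logder_expand k0 (fps_logder_exp charK0 g0); congr fps_logder.
apply/fps_ext => m; rewrite /fps_expand.
case: (boolP (k %| m)%N) => [/dvdnP[d ->]|_]; last by rewrite mulr0.
rewrite mulnK // !coef_fps_natrM coef_fpsN /fps_dil coef_fpsD coef_fpsN coef_fps1.
case: d => [|d]; first by rewrite /fps_theta /fps_geom subrr !mul0r !(mulr0, oppr0).
rewrite theta_logser ?muln_gt0 ?k0 // /fps_theta /g coef_fpsN /fps_dil /= subr0 mulr1 mulnC.
by have := natrS_neq0 charK0 d; move: d.+1%:R => x x0; field.
Qed.

Lemma bcoef_hfun_rect k n : (0 < k)%N ->
  bcoef (@hfun K) (k * n) (Rfun a (k * n)) (nseq n k) =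
  fps_exp (- fps_dil (-1) (fps_logser (fun i => b (k * i)%N))) n.
Proof.
move=> k0; pose eta := fps_expand k (fps_1addX K).
have eta0 : eta 0%N = 1 by rewrite /eta /fps_expand dvdn0 div0n.
have logder_eta := fps_logder_expand k0 (fps_logder_1addX K).
have logder_rho := fps_logder_expand_exp k0; set rho := fps_expand k _ in logder_rho.
have rho0 : rho 0%N = 1 by rewrite /rho /fps_expand dvdn0 div0n coef0_fps_exp.
rewrite -(coef_fps_expand k0) -[fps_expand k _]/rho.
rewrite -(Rfun_specialization (phi := idfun) _ charK0 a0 logder_a eta0 logder_eta rho0) //.
rewrite (bigD1_seq (nseq n k)) ?partns_uniq ?mem_partns_nseq //=.
rewrite (prod_fps_expand_1addX _ k0 (mem_partns_nseq n k0)) eqxx mulr1.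
rewrite big_seq_cond big1 ?addr0 // => l /andP[ln /negPf neq].
by rewrite (prod_fps_expand_1addX _ k0 ln) neq mulr0.
Qed.

Lemma bcoef_hfun_row n : (0 < n)%N -> bcoef (@hfun K) n (Rfun a n) [:: n] = b n.
Proof.
move=> n0; have := bcoef_hfun_rect 1 n0; rewrite muln1 => ->.
rewrite coef1_fps_exp ?coef_fpsN ?coef0_fps_dil ?oppr0 //.
by rewrite /fps_dil expr1 mulN1r opprK /= muln1 divr1.
Qed.

(* The coefficient of h_i h_j is read off the quadratic part of the specialization
   h_i, h_j |-> X, all other h_k |-> 0. *)
Lemma bcoef_hfun_pair i j (n := (i + j)%N) : (0 < i)%N -> (0 < j)%N ->
  bcoef (@hfun K) n (Rfun a n) [:: maxn i j; minn i j] =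
  (b i * b j - b n) *+ (i != j).+1 / 2%:R.
Proof.
move=> i0 j0; pose q := pairser K i j; have n0 : (0 < n)%N by rewrite addn_gt0 i0.
have eta0 : linser q 0%N = 1.
  by rewrite /linser /q /pairser /= !(eq_sym 0%N) !gtn_eqF // scale0r addr0.
have [pi logder_pi] : exists pi, fps_logder (linser q) pi.
  by exists (fps_theta (linser q) * fps_inv (linser q)); apply/fps_logderE.
pose c := fps_theta (fps_logser b); have c0 : c 0%N = 0 := fps_logder_coef0 logder_a a0.
have [|rho rho0 logder_rho] :=
  fps_logder_solution charK0 (@polyC K) (c := fun k => (c k)%:P * pi k).
  by rewrite c0 mul0r.
have two0 : 2%:R != 0 :> K by apply: natrS_neq0.
apply: (mulIf two0); rewrite divfK // -!theta_logser // -quadratic_coef_pairser.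
rewrite -(xcoef2_specialization charK0 c0 logder_pi rho0 logder_rho) coef_fps_natrM mulrC.
congr (_ * _); rewrite /xcoef.
rewrite -(Rfun_specialization (phi := @polyC K) n charK0 a0 logder_a eta0 logder_pi rho0) //.
have pair_n : [:: maxn i j; minn i j] \in partns n.
  by rewrite mem_partns /is_partn /= !inE /geq /=; lia.
rewrite coef_sum (bigD1_seq _ pair_n) ?partns_uniq //= mul_polyC coefZ coef_prod_pairser //.
rewrite eqxx mulr1 big_seq_cond big1 ?addr0 // => l /andP[ln /negPf neq].
by rewrite mul_polyC coefZ coef_prod_pairser // neq mulr0.
Qed.

End HCoefficients.

(** * Alternants *)

Section Determinants.
Variable A : comNzRingType.

Lemma det_sum_cols N (I : finType) (P : 'I_N -> pred I) (F : 'I_N -> 'I_N -> I -> A) :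
  \det (\matrix_(i, j) \sum_(u | P j u) F i j u) =
  \sum_(mu : {ffun 'I_N -> I} | mu \in family P) \det (\matrix_(i, j) F i j (mu j)).
Proof.
rewrite -[LHS]det_tr {1}/determinant; transitivity (\sum_(s : 'S_N)
    \sum_(mu : {ffun 'I_N -> I} | mu \in family P) (-1) ^+ s * \prod_j F (s j) j (mu j)).
  apply: eq_bigr => s _; rewrite -mulr_sumr; congr (_ * _).
  under eq_bigr do rewrite !mxE.
  exact: bigA_distr_big_dep.
rewrite exchange_big; apply: eq_bigr => mu _; rewrite -det_tr.
by apply: eq_bigr => s _; congr (_ * _); apply: eq_bigr => j _; rewrite !mxE.
Qed.

Lemma det_sub_next_col N (B : nat -> nat -> A) (c : nat -> A) :
  \det (\matrix_(i < N.+1, j < N.+1) (B i j - if (j < N)%N then c j * B i j.+1 else 0)) =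
  \det (\matrix_(i < N.+1, j < N.+1) B i j).
Proof.
pose U : 'M[A]_N.+1 := \matrix_(k, j) ((k == j)%:R - (k == j.+1 :> nat)%:R * c j).
have detU : \det U = 1.
  rewrite det_trig.
    by rewrite big1 // => i _; rewrite mxE eqxx (ltn_eqF (ltnSn _)) mul0r subr0.
  apply/is_trig_mxP => i j ltij; rewrite mxE -val_eqE /= !ltn_eqF ?mul0r ?subr0 //.
  exact: leqW.
rewrite -[RHS]mulr1 -detU -det_mulmx; congr (\det _); apply/matrixP => i j; rewrite !mxE.
under [RHS]eq_bigr do rewrite !mxE mulrBr.
rewrite sumrB (bigD1 j) //= eqxx mulr1 big1 ?addr0 => [|k /negPf->]; last by rewrite mulr0.
congr (_ - _); symmetry; transitivity (\sum_(k < N.+1 | k == j.+1 :> nat) c j * B i k).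
  rewrite [RHS]big_mkcond; apply: eq_bigr => k _.
  by case: eqP => _; rewrite ?mul0r ?mulr0 // mul1r mulrC.
by rewrite (big_ord1_eq _ (fun k => c j * B i k)).
Qed.

Lemma det_last_row N (M : 'M[A]_N.+1) : (forall j : 'I_N, M ord_max (lift ord_max j) = 0) ->
  \det M = M ord_max ord_max * \det (row' ord_max (col' ord_max M)).
Proof.
move=> M0; rewrite (expand_det_row _ ord_max) (bigD1_ord ord_max) //= big1 ?addr0.
  by rewrite /cofactor -signr_odd oddD addbb mul1r.
by move=> j _; rewrite M0 mul0r.
Qed.

Lemma det_scale_rows N (c : 'I_N -> A) (M : 'I_N -> 'I_N -> A) :
  \det (\matrix_(i, j) (c i * M i j)) = \prod_i c i * \det (\matrix_(i, j) M i j).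
Proof.
have -> : \matrix_(i, j) (c i * M i j) = diag_mx (\row_i c i) *m \matrix_(i, j) M i j.
  by apply/matrixP => i j; rewrite mul_diag_mx !mxE.
by rewrite det_mulmx det_diag; congr (_ * _); apply: eq_bigr => i _; rewrite mxE.
Qed.

Lemma det_scale_cols N (c : 'I_N -> A) (M : 'I_N -> 'I_N -> A) :
  \det (\matrix_(i, j) (c j * M i j)) = \prod_j c j * \det (\matrix_(i, j) M i j).
Proof.
have -> : \matrix_(i, j) (c j * M i j) = \matrix_(i, j) M i j *m diag_mx (\row_j c j).
  by apply/matrixP => i j; rewrite mul_mx_diag !mxE mulrC.
by rewrite det_mulmx det_diag mulrC; congr (_ * _); apply: eq_bigr => j _; rewrite mxE.
Qed.

End Determinants.

Definition alternant (A : comNzRingType) (x : nat -> A) N (v : nat -> nat) : A :=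
  \det (\matrix_(i < N, j < N) x i ^+ v j).

Section Alternant.
Variables (A : comNzRingType) (x : nat -> A).

Lemma eq_alternant N v w :
  (forall j, (j < N)%N -> v j = w j) -> alternant x N v = alternant x N w.
Proof. by move=> eqv; congr (\det _); apply/matrixP=> i j; rewrite !mxE eqv. Qed.

Lemma subr_mul_sum_powers (y z : A) m n : (m <= n)%N ->
  (y - z) * \sum_(m <= k < n) y ^+ k * z ^+ (n - k.+1) = y ^+ n - z ^+ (n - m) * y ^+ m.
Proof.
move=> lemn; rewrite mulr_sumr.
rewrite (eq_big_nat _ _ (F2 := fun k => y ^+ k.+1 * z ^+ (n - k.+1) - y ^+ k * z ^+ (n - k))).
  by rewrite telescope_sumr // subnn expr0 mulr1 [_ * y ^+ m]mulrC.
by move=> k /andP[_ ltkn]; rewrite -[(n - k)%N]subnSK // !exprS; ring.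
Qed.

Lemma alternant_recr N v : (forall j, (j < N)%N -> (v j.+1 <= v j)%N) ->
  alternant x N.+1 v = \prod_(i < N) (x i - x N) * x N ^+ v N *
    \det (\matrix_(i < N, j < N) \sum_(v j.+1 <= m < v j) x i ^+ m * x N ^+ (v j - m.+1)).
Proof.
move=> decv; rewrite /alternant -(@det_sub_next_col _ N (fun i j => x i ^+ v j)
  (fun j => x N ^+ (v j - v j.+1))) det_last_row => [|j]; last first.
  by rewrite mxE lift_max ltn_ord -exprD subnK ?decv // subrr.
rewrite mxE ltnn subr0 [_ * x N ^+ _]mulrC -mulrA -(det_scale_rows (fun i => x i - x N)).
congr (_ * \det _).
apply/matrixP => i j; rewrite !mxE !lift_max ltn_ord subr_mul_sum_powers //.
exact: decv.
Qed.

(* The exponents of a_(lam + delta), delta = (N - 1, ..., 1, 0) *)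
Definition delta_shift N (lam : nat -> nat) (j : nat) : nat := (lam j + (N.-1 - j))%N.

Definition extend0 c N (mu : {ffun 'I_N -> 'I_c.+1}) (i : nat) : nat :=
  oapp (fun j : 'I_N => mu j : nat) 0%N (insub i).

Lemma extend0E c N (mu : {ffun 'I_N -> 'I_c.+1}) (j : 'I_N) : extend0 mu j = mu j.
Proof. by rewrite /extend0 valK. Qed.

Lemma extend0_out c N (mu : {ffun 'I_N -> 'I_c.+1}) i : (N <= i)%N -> extend0 mu i = 0%N.
Proof. by move=> leNi; rewrite /extend0 insubF // ltnNge leNi. Qed.

Definition interlace c N (lam : nat -> nat) (mu : {ffun 'I_N -> 'I_c.+1}) : bool :=
  [forall j : 'I_N, (lam j.+1 <= mu j <= lam j)%N].

Lemma nonincr_leq (lam : nat -> nat) : (forall i, (lam i.+1 <= lam i)%N) ->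
  {homo lam : i j / (i <= j)%N >-> (j <= i)%N}.
Proof.
move=> declam; apply: (homo_leq (r := fun m n => n <= m)%N) => // n m p le_nm.
by move/leq_trans; apply.
Qed.

Lemma alternant_branch c N lam : (forall i, (lam i.+1 <= lam i)%N) -> (lam 0 <= c)%N ->
  alternant x N.+1 (delta_shift N.+1 lam) = \prod_(i < N) (x i - x N) *
  \sum_(mu : {ffun 'I_N -> 'I_c.+1} | interlace lam mu)
     x N ^+ (\sum_(j < N.+1) (lam j - extend0 mu j)) *
     alternant x N (delta_shift N (extend0 mu)).
Proof.
move=> declam lam0c; have lam_c j : (lam j <= c)%N.
  exact: leq_trans (nonincr_leq declam (leq0n j)) lam0c.
rewrite alternant_recr => [|j ltjN]; last by have := declam j; rewrite /delta_shift; lia.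
rewrite {1}/delta_shift subnn addn0 -mulrA; congr (_ * _).
pose F (i j : 'I_N) (u : 'I_c.+1) := x i ^+ (u + (N.-1 - j)) * x N ^+ (lam j - u).
transitivity (x N ^+ lam N * \det (\matrix_(i < N, j < N)
    \sum_(u : 'I_c.+1 | (lam j.+1 <= u <= lam j)%N) F i j u)).
  congr (_ * \det _); apply/matrixP => i j; rewrite !mxE; have ltjN := ltn_ord j.
  rewrite /delta_shift big_addn (_ : (_ - _ = (lam j).+1)%N); last by rewrite /=; lia.
  rewrite big_geq_mkord /= (big_ord_widen_cond c.+1 (fun i => lam j.+1 <= i)%N
    (fun u => x i ^+ (u + (N - j.+1)) * x N ^+ (lam j + (N - j) - (u + (N - j.+1)).+1)));
    last by rewrite ltnS.
  apply: eq_big => [u|u _]; first by rewrite ltnS.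
  by rewrite /F; congr (_ ^+ _ * _ ^+ _); lia.
rewrite det_sum_cols mulr_sumr; apply: eq_big => [mu|mu _].
  by apply/familyP/forallP => mui j; have := mui j.
rewrite big_ord_recr /= extend0_out // subn0 addnC exprD -mulrA; congr (_ * _).
rewrite expr_sum -det_scale_cols; congr (\det _); apply/matrixP => i j.
by rewrite !mxE /F /delta_shift !extend0E mulrC.
Qed.

End Alternant.

(** * Semistandard tableaux and the bialternant formula *)

Section Tableaux.
Variables r c : nat.
Local Notation box := ('I_r * 'I_c)%type.
Implicit Types (D E : {set box}) (lam mu : nat -> nat).

Definition diagram lam : {set box} := [set p : box | (p.2 < lam p.1)%N].

Definition in_box lam : Prop := forall i, (lam i <= if (i < r)%N then c else 0)%N.

Definition row_len D (i : nat) : nat := #|[set p in D | p.1 == i :> nat]|.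

Definition row_closed D : bool :=
  [forall i : 'I_r, forall j : 'I_c, forall j' : 'I_c,
     (j <= j')%N && ((i, j') \in D) ==> ((i, j) \in D)].

Definition horizontal_strip D E : bool := (E \subset D) &&
  [forall i : 'I_r, forall i' : 'I_r, forall j : 'I_c,
     (i < i')%N && ((i', j) \in D) ==> ((i, j) \in E)].

Lemma row_closedP D :
  reflect (forall i (j j' : 'I_c), (j <= j')%N -> (i, j') \in D -> (i, j) \in D)
          (row_closed D).
Proof.
apply: (iffP 'forall_'forall_'forall_implyP) => closedD i j j'.
  by move=> lej Dj'; apply: (closedD i j j'); rewrite lej.
by case/andP; apply: closedD.
Qed.

Lemma horizontal_stripP D E :
  reflect (E \subset D /\ forall (i i' : 'I_r) j, (i < i')%N -> (i', j) \in D -> (i, j) \in E)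
          (horizontal_strip D E).
Proof.
apply: (iffP andP) => -[sED stripDE]; split=> //.
  move: stripDE => /'forall_'forall_'forall_implyP stripDE i i' j lti Di'j.
  by apply: (stripDE i i' j); rewrite lti.
by apply/'forall_'forall_'forall_implyP => i i' j /andP[]; apply: stripDE.
Qed.

Lemma row_closed_diagram lam : row_closed (diagram lam).
Proof. by apply/row_closedP => i j j' lej; rewrite !inE; apply: leq_ltn_trans. Qed.

Lemma card_ord_interval m n : (n <= c)%N -> #|[set k : 'I_c | (m <= k < n)%N]| = (n - m)%N.
Proof.
move=> lenc; rewrite -sum1dep_card -[RHS]muln1 -sum_nat_const_nat big_geq_mkord /=.
by rewrite (big_ord_widen_cond c (leq m) (fun=> 1%N)).
Qed.

Lemma row_lenE D (i : 'I_r) : row_len D i = #|[set j | (i, j) \in D]|.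
Proof.
have inj_i : injective (fun j : 'I_c => (i, j)) by move=> j j' [].
rewrite -(card_imset _ inj_i); apply: eq_card => -[i' j]; rewrite !inE /=.
apply/andP/imsetP => [[Dij /eqP/ord_inj eqi]|[k]]; first by exists j; rewrite ?inE -eqi.
by rewrite inE => Dik [-> ->].
Qed.

Lemma row_len_out D i : (r <= i)%N -> row_len D i = 0%N.
Proof.
move=> leri; apply/eqP; rewrite cards_eq0; apply/eqP/setP => -[i' j]; rewrite !inE /=.
by rewrite (ltn_eqF (leq_trans (ltn_ord i') leri)) andbF.
Qed.

Lemma in_box_row_len D : in_box (row_len D).
Proof.
move=> i; case: ltnP => [ltir|leri]; last by rewrite row_len_out.
by rewrite (row_lenE D (Ordinal ltir)) -[X in (_ <= X)%N]card_ord max_card.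
Qed.

Lemma row_len_diagramD lam mu i : in_box lam ->
  row_len (diagram lam :\: diagram mu) i = (lam i - mu i)%N.
Proof.
move=> boxlam; have := boxlam i; case: ltnP => [ltir lelamc|leri]; last first.
  by rewrite leqn0 row_len_out // => /eqP->.
rewrite (row_lenE _ (Ordinal ltir)) -card_ord_interval //.
by apply: eq_card => j; rewrite !inE -leqNgt.
Qed.

Lemma row_len_diagram lam i : in_box lam -> row_len (diagram lam) i = lam i.
Proof.
move=> boxlam; rewrite -[RHS]subn0 -(@row_len_diagramD _ (fun=> 0%N)) //.
by congr row_len; apply/setP => p; rewrite !inE.
Qed.

Lemma diagram_row_len D : row_closed D -> diagram (row_len D) = D.
Proof.
move=> /row_closedP closedD; apply/setP => -[i j]; rewrite inE /= row_lenE.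
have card_lt k : (k <= c)%N -> #|[set j : 'I_c | (j < k)%N]| = k.
  by move=> lekc; rewrite -[RHS]subn0 -card_ord_interval.
apply/idP/idP => [|Dij]; last first.
  rewrite -(card_lt j.+1) //; apply/subset_leq_card/subsetP => k.
  by rewrite !inE ltnS => lekj; apply: closedD lekj Dij.
apply: contraLR => Dij; rewrite -leqNgt -[X in (_ <= X)%N](card_lt j (ltnW (ltn_ord j))).
apply/subset_leq_card/subsetP => k; rewrite !inE ltnNge => Dik.
by apply: contra Dij => /closedD; apply.
Qed.

Lemma card_row_len D M : (forall p, p \in D -> (p.1 < M)%N) ->
  #|D| = (\sum_(i < M) row_len D i)%N.
Proof.
case: M => [|M] ltM.
  rewrite big_ord0; apply/eqP; rewrite cards_eq0; apply/eqP/setP => p; rewrite inE.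
  by apply/negP => /ltM.
rewrite -sum1_card (partition_big (fun p : box => inord p.1 : 'I_M.+1) xpredT) //.
apply: eq_bigr => i _; rewrite /row_len -sum1dep_card; apply: eq_bigl => p.
by case: (boolP (p \in D)) => // /ltM ltpM; rewrite -val_eqE /= inordK.
Qed.

Lemma card_diagramD lam mu M : in_box lam -> (forall i, (M <= i)%N -> lam i = 0%N) ->
  #|diagram lam :\: diagram mu| = (\sum_(i < M) (lam i - mu i))%N.
Proof.
move=> boxlam lam0; rewrite (@card_row_len _ M) => [|p].
  by apply: eq_bigr => i _; rewrite row_len_diagramD.
by rewrite !inE => /andP[_]; apply: contraTltn => /lam0->.
Qed.

Lemma in_box_lt lam i k : in_box lam -> (k < lam i)%N -> (i < r)%N /\ (k < c)%N.
Proof.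
move=> boxlam ltk; have := leq_trans ltk (boxlam i).
by case: ifP => // ltir ltkc.
Qed.

Lemma horizontal_strip_diagram lam mu : (forall i, (lam i.+1 <= lam i)%N) ->
    in_box lam -> in_box mu ->
  reflect (forall i, (lam i.+1 <= mu i <= lam i)%N)
          (horizontal_strip (diagram lam) (diagram mu)).
Proof.
move=> declam boxlam boxmu.
apply: (iffP (horizontal_stripP _ _)) => [[/subsetP sub strip] i|inter].
  apply/andP; split; rewrite leqNgt; apply/negP => lt_lam.
    have [ltir ltc] := in_box_lt boxlam lt_lam.
    have := strip (Ordinal (ltnW ltir)) (Ordinal ltir) (Ordinal ltc).
    by rewrite !inE /= ltnn => /(_ (ltnSn i) lt_lam).
  have [ltir ltc] := in_box_lt boxmu lt_lam.
  by have := sub (Ordinal ltir, Ordinal ltc); rewrite !inE /= ltnn => /(_ lt_lam).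
split; first by apply/subsetP => p; rewrite !inE => /leq_trans; apply; case/andP: (inter p.1).
move=> i i' j lti; rewrite !inE /= => /leq_trans; apply.
have /andP[le_mu _] := inter i; apply: leq_trans le_mu.
exact: nonincr_leq.
Qed.

Definition semistd N (T : {ffun box -> 'I_N.+1}) : bool :=
  [forall i, forall j : 'I_c, forall j' : 'I_c, (j <= j')%N ==> (T (i, j) <= T (i, j'))%N] &&
  [forall i : 'I_r, forall i' : 'I_r, forall j,
     (i < i')%N && (T (i', j) < N)%N ==> (T (i, j) < T (i', j))%N].

Definition tab_shape N (T : {ffun box -> 'I_N.+1}) m : {set box} := [set p | (T p < m)%N].

Lemma semistdP N (T : {ffun box -> 'I_N.+1}) :
  reflect ((forall i (j j' : 'I_c), (j <= j')%N -> (T (i, j) <= T (i, j'))%N) /\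
           (forall (i i' : 'I_r) j, (i < i')%N -> (T (i', j) < N)%N ->
              (T (i, j) < T (i', j))%N))
          (semistd T).
Proof.
apply: (iffP andP) => -[rowT colT].
  move: rowT colT => /'forall_'forall_'forall_implyP rowT /'forall_'forall_'forall_implyP colT.
  by split=> // i i' j lti ltN; apply: colT; rewrite lti.
split; apply/'forall_'forall_'forall_implyP => // i i' j /andP[]; apply: colT.
Qed.

(* Entries equal to the bound are cells outside the shape; truncation removes the
   cells with the largest entry. *)
Definition truncate N (T : {ffun box -> 'I_N.+2}) : {ffun box -> 'I_N.+1} :=
  [ffun p => inord (minn (T p) N)].

Lemma truncateE N (T : {ffun box -> 'I_N.+2}) p : truncate T p = minn (T p) N :> nat.
Proof. by rewrite ffunE inordK // ltnS geq_minr. Qed.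

Lemma tab_shape_truncate N (T : {ffun box -> 'I_N.+2}) :
  tab_shape (truncate T) N = tab_shape T N.
Proof. by apply/setP => p; rewrite !inE truncateE; lia. Qed.

Lemma semistd_truncate N (T : {ffun box -> 'I_N.+2}) : row_closed (tab_shape T N.+1) ->
  semistd T = semistd (truncate T) && horizontal_strip (tab_shape T N.+1) (tab_shape T N).
Proof.
move=> /row_closedP closedT; apply/semistdP/andP => [[rowT colT]|[/semistdP[rowT colT]]].
  split; first apply/semistdP; first split.
  - by move=> i j j' lej; have := rowT i j j' lej; rewrite !truncateE; lia.
  - by move=> i i' j lti; have := colT i i' j lti; rewrite !truncateE; lia.
  apply/horizontal_stripP; split=> [|i i' j lti].
    by apply/subsetP => p; rewrite !inE; lia.
  by have := colT i i' j lti; rewrite !inE; lia.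
case/horizontal_stripP => _ stripT; split=> [i j j' lej|i i' j lti].
  have := rowT i j j' lej; have := closedT i j j' lej; rewrite !truncateE !inE.
  by move: (T (i, j)) (T (i, j')) => [u /= ltu] [v /= ltv]; lia.
have := colT i i' j lti; have := stripT i i' j lti; rewrite !truncateE !inE.
by move: (T (i, j)) (T (i', j)) => [u /= ltu] [v /= ltv]; lia.
Qed.

Lemma row_closed_tab_shape N (T : {ffun box -> 'I_N.+1}) m :
  semistd T -> row_closed (tab_shape T m).
Proof.
case/semistdP => rowT _; apply/row_closedP => i j j' /(rowT i) leT.
by rewrite !inE; apply: leq_ltn_trans.
Qed.

Lemma leq_row_semistd N (T : {ffun box -> 'I_N.+1}) i j :
  semistd T -> (T (i, j) < N)%N -> (i <= T (i, j))%N.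
Proof.
case/semistdP => _ colT; case: i; elim=> // i IHi ltir ltN.
have ltT := colT (Ordinal (ltnW ltir)) (Ordinal ltir) j (ltnSn i) ltN.
exact: leq_ltn_trans (IHi (ltnW ltir) (ltn_trans ltT ltN)) ltT.
Qed.

Lemma row_len_tab_shape_out N (T : {ffun box -> 'I_N.+1}) i :
  semistd T -> (N <= i)%N -> row_len (tab_shape T N) i = 0%N.
Proof.
move=> ssT leNi; apply/eqP; rewrite cards_eq0; apply/eqP/setP => -[i' j]; rewrite !inE /=.
apply/negP => /andP[ltN /eqP eqi]; have := leq_row_semistd ssT ltN.
by rewrite eqi leqNgt (leq_trans ltN).
Qed.

Section GeneratingFunction.
Variables (A : comNzRingType) (x : nat -> A).

Definition tab_gf D N : A :=
  \sum_(T : {ffun box -> 'I_N.+1} | semistd T && (tab_shape T N == D)) \prod_(p in D) x (T p).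

Definition extend_tab N D (T : {ffun box -> 'I_N.+1}) : {ffun box -> 'I_N.+2} :=
  [ffun p => if p \in D then inord (T p) else ord_max].

Lemma extend_tabE N D (T : {ffun box -> 'I_N.+1}) p :
  extend_tab D T p = (if p \in D then T p : nat else N.+1) :> nat.
Proof. by rewrite ffunE; case: ifP => // _; rewrite inordK // ltnW // ltnS. Qed.

Lemma tab_shape_extend N D (T : {ffun box -> 'I_N.+1}) :
  tab_shape (extend_tab D T) N.+1 = D.
Proof.
apply/setP => p; rewrite inE extend_tabE; case: ifP => _; last by rewrite ltnn.
by rewrite ltn_ord.
Qed.

Lemma truncateK N D (T : {ffun box -> 'I_N.+2}) :
  tab_shape T N.+1 = D -> extend_tab D (truncate T) = T.
Proof.
move=> <-; apply/ffunP => p; apply: ord_inj; rewrite extend_tabE truncateE inE.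
by move: (T p) => [u /= ltu]; case: ifP; lia.
Qed.

Lemma extend_tabK N D (T : {ffun box -> 'I_N.+1}) :
  (truncate (extend_tab D T) == T) = (tab_shape T N \subset D).
Proof.
apply/eqP/subsetP => [<- p|sub]; last first.
  apply/ffunP => p; apply: ord_inj; rewrite truncateE extend_tabE.
  by have := sub p; rewrite inE; move: (T p) => [u /= ltu]; case: ifP => // _; lia.
by rewrite inE truncateE extend_tabE; case: ifP => //; lia.
Qed.

(* The cells containing the largest entry form a horizontal strip. *)
Lemma tab_gf_recr D N : row_closed D -> tab_gf D N.+1 =
  \sum_(T : {ffun box -> 'I_N.+1} | semistd T && horizontal_strip D (tab_shape T N))
    x N ^+ #|D :\: tab_shape T N| * \prod_(p in tab_shape T N) x (T p).
Proof.
move=> closedD; rewrite /tab_gf (reindex_onto (extend_tab D) (@truncate N)); last first.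
  by move=> T /andP[_ /eqP]; apply: truncateK.
apply: eq_big => [T|T].
  rewrite tab_shape_extend eqxx andbT semistd_truncate tab_shape_extend // extend_tabK.
  have [sub|/negPf nsub] := boolP (tab_shape T N \subset D); last first.
    by rewrite andbF /horizontal_strip nsub andbF.
  have truncT : truncate (extend_tab D T) = T by apply/eqP; rewrite extend_tabK.
  by rewrite -tab_shape_truncate truncT andbT.
rewrite extend_tabK => /andP[_ sub].
rewrite (big_setID (tab_shape T N)) /= (setIidPr sub) mulrC; congr (_ * _).
  rewrite (eq_bigr (fun=> x N)) ?prodr_const // => p; rewrite !inE => /andP[leN pD].
  by rewrite extend_tabE pD; congr x; move: (T p) leN => [u /= ltu]; lia.
by apply: eq_bigr => p pT; rewrite extend_tabE (subsetP sub).
Qed.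

Lemma tab_gf_last0 D N : row_closed D -> x N = 0 -> tab_gf D N.+1 = tab_gf D N.
Proof.
move=> closedD xN0; rewrite tab_gf_recr // (bigID (fun T => tab_shape T N == D)) /=.
rewrite [X in _ + X]big1 ?addr0 => [|T /andP[/andP[_ /andP[sub _]] neq]]; last first.
  rewrite xN0 expr0n cards_eq0 setD_eq0 (_ : D \subset _ = false) ?mul0r //.
  by apply: contraNF neq => supD; rewrite eqEsubset sub.
apply: eq_big => [T|T /andP[_ /eqP->]]; last by rewrite setDv cards0 mul1r.
have [shT|] := eqVneq (tab_shape T N) D; rewrite ?andbF // !andbT -shT.
case: (boolP (semistd T)) => //= /semistdP[_ colT]; apply/horizontal_stripP; split=> //.
by move=> i i' j lti; rewrite !inE => ltN; apply: ltn_trans (colT i i' j lti ltN) ltN.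
Qed.

Lemma tab_gf_row_out D N p : p \in D -> (N <= p.1)%N -> tab_gf D N = 0.
Proof.
move=> pD leN; rewrite /tab_gf big1 // => T /andP[ssT /eqP shT].
have := pD; rewrite -shT inE; case: p pD leN => i j /= _ leN ltN.
by have := leq_row_semistd ssT ltN; rewrite leqNgt (leq_trans ltN).
Qed.

Lemma interlaceP c' N lam (mu : {ffun 'I_N -> 'I_c'.+1}) :
    (forall i, (N < i)%N -> lam i = 0%N) ->
  reflect (forall i, (lam i.+1 <= extend0 mu i <= lam i)%N) (interlace lam mu).
Proof.
move=> lam0; apply: (iffP forallP) => inter i; last by rewrite -extend0E.
case: (ltnP i N) => [ltiN|leNi].
  by rewrite (extend0E _ (Ordinal ltiN)); apply: (inter (Ordinal ltiN)).
by rewrite extend0_out // lam0.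
Qed.

Lemma in_box_interlace N lam (mu : {ffun 'I_N -> 'I_c.+1}) : in_box lam ->
  (forall i, (lam i.+1 <= extend0 mu i <= lam i)%N) -> in_box (extend0 mu).
Proof. by move=> boxlam inter i; case/andP: (inter i) => _ /leq_trans; apply. Qed.

Definition row_lens N (T : {ffun box -> 'I_N.+1}) : {ffun 'I_N -> 'I_c.+1} :=
  [ffun i : 'I_N => inord (row_len (tab_shape T N) i)].

Lemma extend0_row_lens N (T : {ffun box -> 'I_N.+1}) :
  semistd T -> extend0 (row_lens T) =1 row_len (tab_shape T N).
Proof.
move=> ssT i; case: (ltnP i N) => [ltiN|leNi]; last first.
  by rewrite extend0_out // row_len_tab_shape_out.
rewrite (extend0E _ (Ordinal ltiN)) ffunE inordK // ltnS.
by apply: leq_trans (in_box_row_len _ i) _; case: ifP.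
Qed.

Lemma tab_shape_row_lens N (T : {ffun box -> 'I_N.+1}) :
  semistd T -> tab_shape T N = diagram (extend0 (row_lens T)).
Proof.
move=> ssT; rewrite -[LHS]diagram_row_len ?row_closed_tab_shape //.
by apply/setP => p; rewrite !inE extend0_row_lens.
Qed.

Lemma tab_gf_branch N lam : (forall i, (lam i.+1 <= lam i)%N) -> in_box lam ->
    (forall i, (N < i)%N -> lam i = 0%N) ->
  tab_gf (diagram lam) N.+1 = \sum_(mu : {ffun 'I_N -> 'I_c.+1} | interlace lam mu)
    x N ^+ (\sum_(j < N.+1) (lam j - extend0 mu j)) * tab_gf (diagram (extend0 mu)) N.
Proof.
move=> declam boxlam lamN; rewrite tab_gf_recr ?row_closed_diagram //.
have strip_interlace (mu : {ffun 'I_N -> 'I_c.+1}) : in_box (extend0 mu) ->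
    horizontal_strip (diagram lam) (diagram (extend0 mu)) = interlace lam mu.
  by move=> boxmu; apply/horizontal_strip_diagram/interlaceP.
have box_row_lens (T : {ffun box -> 'I_N.+1}) : semistd T -> in_box (extend0 (row_lens T)).
  by move=> ssT i; rewrite extend0_row_lens //; apply: in_box_row_len.
rewrite (partition_big (@row_lens N) (interlace lam)) => [|T /andP[ssT]]; last first.
  by rewrite tab_shape_row_lens // strip_interlace //; apply: box_row_lens.
apply: eq_bigr => mu inter_mu; have /interlaceP inter := inter_mu.
have boxmu := in_box_interlace boxlam (inter lamN).
rewrite -(card_diagramD _ boxlam lamN) mulr_sumr; apply: eq_big => [T|T].
  case: (boolP (semistd T)) => //= ssT; rewrite tab_shape_row_lens //.
  apply/andP/eqP => [[_ /eqP->] //|eq_diagram].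
  rewrite eq_diagram strip_interlace //; split=> //.
  apply/eqP/ffunP => j; apply: ord_inj; rewrite -!extend0E.
  by rewrite -(row_len_diagram _ (box_row_lens _ ssT)) eq_diagram row_len_diagram.
by case/andP => /andP[ssT _] /eqP <-; rewrite tab_shape_row_lens.
Qed.

Lemma alternant_delta_recr N :
  alternant x N.+1 (delta_shift N.+1 (fun=> 0%N)) =
  \prod_(i < N) (x i - x N) * alternant x N (delta_shift N (fun=> 0%N)).
Proof.
rewrite (@alternant_branch _ x 0) //; congr (_ * _).
have mu0 (mu : {ffun 'I_N -> 'I_1}) i : extend0 mu i = 0%N.
  by case: (ltnP i N) => [lti|/extend0_out //]; rewrite (extend0E _ (Ordinal lti)) ord1.
rewrite (big_pred1 [ffun=> ord0]) => [|mu].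
  rewrite big1 // expr0 mul1r; apply: eq_alternant => j _.
  by rewrite /delta_shift mu0.
have -> : mu = [ffun=> ord0] by apply/ffunP => j; rewrite ffunE ord1.
by rewrite /= eqxx; apply/interlaceP => // i; rewrite mu0.
Qed.

Lemma tab_gf_diagram0 lam : (forall i, lam i = 0%N) -> tab_gf (diagram lam) 0 = 1.
Proof.
move=> lam0; have -> : diagram lam = set0 by apply/setP => p; rewrite !inE lam0.
rewrite /tab_gf (big_pred1 [ffun=> ord0]) ?big_set0 // => T.
have -> : T = [ffun=> ord0] by apply/ffunP => p; rewrite ffunE ord1.
rewrite /= eqxx; apply/andP; split; first by apply/semistdP; split=> i j j'; rewrite !ffunE.
by apply/eqP/setP => p; rewrite !inE.
Qed.

Lemma tab_gf_bialternant N lam : (forall i, (lam i.+1 <= lam i)%N) -> in_box lam ->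
    (forall i, (N <= i)%N -> lam i = 0%N) ->
  alternant x N (delta_shift N (fun=> 0%N)) * tab_gf (diagram lam) N =
  alternant x N (delta_shift N lam).
Proof.
elim: N lam => [|N IHN] lam declam boxlam lamN.
  by rewrite /alternant !det_mx00 mul1r tab_gf_diagram0 // => i; apply: lamN.
have lam0 : (lam 0 <= c)%N by apply: leq_trans (boxlam 0%N) _; case: ifP.
rewrite alternant_delta_recr (alternant_branch x _ declam lam0) tab_gf_branch // -mulrA.
congr (_ * _); rewrite mulr_sumr; apply: eq_bigr => mu /(interlaceP _ lamN) inter.
rewrite mulrCA IHN // => [i||]; last exact: extend0_out.
  by case/andP: (inter i.+1) => _ le1; case/andP: (inter i) => le2 _; apply: leq_trans le2.
exact: in_box_interlace inter.
Qed.

End GeneratingFunction.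

End Tableaux.

Section SchurTableaux.
Variables (K : fieldType) (l : seq nat) (N : nat).
Hypothesis sortl : sorted geq l.
Local Notation box := ('I_(size l) * 'I_(head 0%N l))%type.
Local Notation diagram_l := (@diagram (size l) (head 0%N l) (nth 0%N l)).

Lemma nth_sorted_geq i : (nth 0 l i.+1 <= nth 0 l i)%N.
Proof.
case: (ltnP i.+1 (size l)) => [lti|le]; last by rewrite nth_default.
by apply: (sorted_ltn_nth (rev_trans leq_trans)) => //; rewrite inE ltnW.
Qed.

Lemma is_ssytP (T : {ffun cell l -> 'I_N}) :
  reflect ((forall p q : cell l, (val p).1 = (val q).1 ->
              ((val p).2 <= (val q).2)%N -> (T p <= T q)%N) /\
           (forall p q : cell l, (val p).2 = (val q).2 ->
              ((val p).1 < (val q).1)%N -> (T p < T q)%N))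
          (is_ssyt T).
Proof.
apply: (iffP 'forall_forallP) => [ssT|[rowT colT] p q].
  split=> p q; have := ssT p q; case: (val p) (val q) => [i j] [i' j'] /=.
    by case/andP=> /implyP rowT _ eqi lej; apply: rowT; rewrite eqi eqxx.
  by case/andP=> _ /implyP colT eqj lti; apply: colT; rewrite eqj eqxx.
case Ep: (val p) => [i j]; case Eq: (val q) => [i' j'].
apply/andP; split; apply/implyP => /andP[/eqP eq_pq le_pq].
  by apply: rowT; rewrite Ep Eq.
by apply: colT; rewrite Ep Eq.
Qed.

Lemma mem_diagram (p : cell l) : val p \in diagram_l.
Proof. by rewrite inE (valP p). Qed.

Lemma diagram_cell p : p \in diagram_l -> exists q : cell l, val q = p.
Proof. by rewrite inE => pD; exists (Sub p pD); rewrite SubK. Qed.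

Definition fill_box (T : {ffun cell l -> 'I_N}) : {ffun box -> 'I_N.+1} :=
  [ffun p => oapp (fun q => widen_ord (leqnSn N) (T q)) ord_max (insub p)].

Lemma fill_box_cell T q : fill_box T (val q) = T q :> nat.
Proof. by rewrite ffunE valK. Qed.

Lemma fill_box_out T p : p \notin diagram_l -> fill_box T p = N :> nat.
Proof. by rewrite inE => pD; rewrite ffunE insubN. Qed.

Lemma tab_shape_fill_box T : tab_shape (fill_box T) N = diagram_l.
Proof.
apply/setP => p; rewrite [LHS]inE; have [/diagram_cell[q <-]|pD] := boolP (p \in diagram_l).
  by rewrite fill_box_cell ltn_ord.
by rewrite fill_box_out // ltnn.
Qed.

Lemma fill_box_inj : injective fill_box.
Proof.
move=> T T' eqT; apply/ffunP => q; apply: ord_inj.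
by rewrite -!fill_box_cell eqT.
Qed.

Lemma semistd_fill_box T : semistd (fill_box T) = is_ssyt T.
Proof.
apply/semistdP/is_ssytP => -[rowT colT]; split.
- move=> p q; rewrite -!fill_box_cell; case: (val p) (val q) => [i j] [i' j'] /= ->.
  exact: rowT.
- move=> p q; rewrite -!fill_box_cell; have := ltn_ord (T q); rewrite -fill_box_cell.
  case: (val p) (val q) => [i j] [i' j'] /= ltN -> lti.
  exact: colT.
- move=> i j j' lej.
  have [/diagram_cell[q Eq]|/fill_box_out-> //] := boolP ((i, j') \in diagram_l).
    have [p Ep] : exists p : cell l, val p = (i, j).
      by apply: diagram_cell; have := mem_diagram q; rewrite Eq !inE; apply: leq_ltn_trans.
    by rewrite -Ep -Eq !fill_box_cell; apply: rowT; rewrite Ep Eq.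
  by rewrite -ltnS.
move=> i i' j lti ltN.
have /diagram_cell[q Eq] : (i', j) \in diagram_l by rewrite -(tab_shape_fill_box T) inE.
have [p Ep] : exists p : cell l, val p = (i, j).
  apply: diagram_cell; have := mem_diagram q; rewrite Eq !inE /= => /leq_trans; apply.
  exact: (nonincr_leq nth_sorted_geq (ltnW lti)).
by rewrite -Ep -Eq !fill_box_cell; apply: colT; rewrite Ep Eq.
Qed.

Lemma fill_boxP (T : {ffun box -> 'I_N.+1}) :
  tab_shape T N = diagram_l -> exists T', T = fill_box T'.
Proof.
move=> shT; have ltT (q : cell l) : (T (val q) < N)%N.
  by have := mem_diagram q; rewrite -shT inE.
exists [ffun q => Ordinal (ltT q)]; apply/ffunP => p; apply: ord_inj.
have [/diagram_cell[q <-]|pD] := boolP (p \in diagram_l); first by rewrite fill_box_cell ffunE.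
rewrite fill_box_out //; move: pD; rewrite -shT inE.
by move: (T p) => [u /= ltu]; lia.
Qed.

Definition xvar (i : nat) : {mpoly K[N]} := oapp (fun k : 'I_N => 'X_k) 0 (insub i).

Lemma xvarE (i : 'I_N) : xvar i = 'X_i.
Proof. by rewrite /xvar valK. Qed.

Lemma schur_tab_gf : schur K l N = tab_gf xvar diagram_l N.
Proof.
transitivity (\sum_(T in fill_box @: [set T | is_ssyt T]) \prod_(p in diagram_l) xvar (T p)).
  rewrite big_imset => [|T T' _ _]; last exact: fill_box_inj.
  apply: eq_big => [T|T _]; first by rewrite inE.
  rewrite [RHS](reindex_omap (fun q : cell l => val q) insub) /= => [|p]; last first.
    by rewrite inE => pD; rewrite insubT.
  apply: eq_big => [q|q _]; last by rewrite fill_box_cell xvarE.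
  by rewrite mem_diagram valK eqxx.
apply: eq_bigl => T; apply/imsetP/andP => [[T' ssT' ->]|[ssT /eqP shT]].
  by rewrite semistd_fill_box tab_shape_fill_box eqxx; move: ssT'; rewrite inE.
by have [T' TE] := fill_boxP shT; exists T'; rewrite // inE -semistd_fill_box -TE.
Qed.

Lemma in_box_nth : in_box (size l) (head 0%N l) (nth 0%N l).
Proof.
move=> i; case: ltnP => [_|lei]; last by rewrite nth_default.
by rewrite -nth0; apply: (nonincr_leq nth_sorted_geq).
Qed.

Lemma schur_bialternant : (size l <= N)%N ->
  alternant xvar N (delta_shift N (fun=> 0%N)) * schur K l N =
  alternant xvar N (delta_shift N (nth 0%N l)).
Proof.
move=> leN; rewrite schur_tab_gf; apply: tab_gf_bialternant => [||i leNi].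
- exact: nth_sorted_geq.
- exact: in_box_nth.
by rewrite nth_default // (leq_trans leN).
Qed.

Lemma schur_eq0 : 0%N \notin l -> (N < size l)%N -> schur K l N = 0.
Proof.
move=> l0 ltN; have nth_gt0 i : (i < size l)%N -> (0 < nth 0 l i)%N.
  by move=> lti; rewrite lt0n; apply: contra l0 => /eqP <-; apply: mem_nth.
have head_gt0 : (0 < head 0 l)%N by rewrite -nth0 nth_gt0 // (leq_trans _ ltN).
rewrite schur_tab_gf (@tab_gf_row_out _ _ _ _ _ _ (Ordinal ltN, Ordinal head_gt0)) //=.
by rewrite inE /= nth_gt0.
Qed.

Lemma card_cell : #|cell l| = sumn l.
Proof.
rewrite card_sig; transitivity #|diagram_l|.
  by apply: eq_card => p; rewrite !inE.
rewrite (@card_row_len _ _ _ (size l)) => [|p _]; last exact: ltn_ord.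
rewrite sumnE (big_nth 0%N) big_mkord; apply: eq_bigr => i _.
by rewrite row_len_diagram //; apply: in_box_nth.
Qed.

Lemma homog_schur : schur K l N \is (sumn l).-homog.
Proof.
apply: rpred_sum => T _; rewrite mprodXE dhomogX /= mdeg_sum.
rewrite (eq_bigr (fun=> 1%N)) => [|p _]; last exact: mdeg1.
by rewrite sum1_card card_cell.
Qed.

End SchurTableaux.

Lemma drop_last_var_xvar (K : fieldType) N i : drop_last_var (xvar K N.+1 i) = xvar K N i.
Proof.
rewrite /xvar /drop_last_var; case: insubP => [k _ <-|]; last first.
  by rewrite -leqNgt => leNi; rewrite insubF ?raddf0 // ltnNge ltnW.
rewrite /= comp_mpolyXU -tnth_nth tnth_mktuple; case: unliftP => [j ->|->].
  by rewrite lift_max valK.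
by rewrite insubF //= ltnn.
Qed.

Lemma drop_last_var_schur (K : fieldType) l N :
  sorted geq l -> drop_last_var (schur K l N.+1) = schur K l N.
Proof.
move=> sortl; rewrite !schur_tab_gf //.
rewrite -[RHS]tab_gf_last0 ?row_closed_diagram //; last by rewrite /xvar insubF ?ltnn.
rewrite /tab_gf /drop_last_var rmorph_sum; apply: eq_bigr => T _.
by rewrite rmorph_prod; apply: eq_bigr => p _; apply: drop_last_var_xvar.
Qed.

(** * Expansions in Schur functions *)

Lemma perm_increasing N (s : 'S_N) :
  {homo s : i j / (i < j)%N} -> s = 1%g.
Proof.
have leq_incr (t : 'S_N) : {homo t : i j / (i < j)%N} -> forall i : 'I_N, (i <= t i)%N.
  move=> incr [i]; elim: i => // i IHi ltiN.
  by apply: leq_ltn_trans (IHi (ltnW ltiN)) _; apply: incr.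
move=> incr; apply/permP => i; apply/ord_inj/eqP; rewrite perm1 eqn_leq leq_incr // andbT.
rewrite -[X in (_ <= nat_of_ord X)%N](permK s i); apply: leq_incr => {}i j ltij.
rewrite ltnNge leq_eqVlt; apply/negP => /orP[/eqP/ord_inj/perm_inj eqij|/incr].
  by rewrite eqij ltnn in ltij.
by rewrite !permKV ltnNge ltnW.
Qed.

Section AlternantPolynomials.
Variables (K : fieldType) (N : nat).
Implicit Types v w : nat -> nat.

Local Notation alt v := (alternant (xvar K N) N v).

Lemma alternantE v : alt v = \sum_(s : 'S_N) (-1) ^+ s *: 'X_[[multinom v (s i) | i < N]].
Proof.
apply: eq_bigr => s _; rewrite -mul_mpolyC rmorphXn rmorphN1; congr (_ * _).
by rewrite mpolyXE_id; apply: eq_bigr => i _; rewrite !mxE xvarE mnmE.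
Qed.

Lemma msym_alternant v (s : 'S_N) : msym s (alt v) = (-1) ^+ s * alt v.
Proof.
rewrite /alternant -[LHS](det_map_mx (msym s)) -det_perm -det_mulmx -row_permE.
congr (\det _); apply/matrixP=> i j; rewrite !mxE rmorphXn /= !xvarE.
by rewrite /msym mmapX mmap1U.
Qed.

Definition strict_decr v : Prop :=
  forall i j, (i < j)%N -> (j < N)%N -> (v j < v i)%N.

Lemma strict_decr_perm v w (s : 'S_N) : strict_decr v -> strict_decr w ->
  (forall i : 'I_N, v (s i) = w i) -> s = 1%g.
Proof.
move=> decv decw eqvw; apply: perm_increasing => i j ltij; rewrite ltnNge.
have := decw i j ltij (ltn_ord j); rewrite -!eqvw => ltv.
rewrite leq_eqVlt; apply/negP => /orP[/eqP eqs|lts]; first by rewrite eqs ltnn in ltv.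
by have := decv _ _ lts (ltn_ord _); rewrite ltnNge ltnW.
Qed.

Lemma mcoeff_alternant v w : strict_decr v -> strict_decr w ->
  (alt v)@_[multinom w i | i < N] = [forall i : 'I_N, v i == w i]%:R.
Proof.
move=> decv decw; rewrite alternantE raddf_sum (bigD1 1%g) //= big1 ?addr0 => [|s neq1].
  rewrite mcoeffZ mcoeffX odd_perm1 expr0 mul1r; congr (_ : bool)%:R.
  apply/eqP/forallP => [/mnmP vw i|vw]; first by have := vw i; rewrite !mnmE perm1 => ->.
  by apply/mnmP => i; rewrite !mnmE perm1; apply/eqP/vw.
rewrite mcoeffZ mcoeffX; case: eqP => [/mnmP vw|_]; last by rewrite mulr0.
case/eqP: neq1; apply: strict_decr_perm decv decw _ => i.
by have := vw i; rewrite !mnmE.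
Qed.

Lemma strict_decr_delta_shift lam :
  (forall i, (lam i.+1 <= lam i)%N) -> strict_decr (delta_shift N lam).
Proof.
move=> /nonincr_leq declam i j ltij ltjN; rewrite /delta_shift.
by have := declam i j (ltnW ltij); lia.
Qed.

Lemma alternant_delta_neq0 : alt (delta_shift N (fun=> 0%N)) != 0.
Proof.
have dec0 : strict_decr (delta_shift N (fun=> 0%N)) by apply: strict_decr_delta_shift.
apply/eqP => /(congr1 (mcoeff [multinom delta_shift N (fun=> 0%N) i | i < N])).
rewrite mcoeff_alternant // mcoeff0 (_ : [forall i, _]); last by apply/forallP.
by move/eqP; rewrite oner_eq0.
Qed.

End AlternantPolynomials.

Section SchurExpansion.
Variable K : fieldType.

Lemma schur_sym l N : sorted geq l -> 0%N \notin l -> schur K l N \is symmetric.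
Proof.
move=> sortl l0; have [leN|ltN] := leqP (size l) N; last by rewrite schur_eq0 ?rpred0.
apply/issymP => s; apply: (mulfI (alternant_delta_neq0 K N)).
have sgn0 : (-1) ^+ s != 0 :> {mpoly K[N]} by rewrite signr_eq0.
apply: (mulfI sgn0); rewrite mulrA -msym_alternant -msymM.
by rewrite schur_bialternant // msym_alternant.
Qed.

Lemma homog_symfun_schur n l : l \in partns n -> homog_symfun n (schur K l).
Proof.
rewrite mem_partns => /and3P[sortl l0 /eqP <-]; split=> N.
- exact: schur_sym.
- exact: homog_schur.
exact: drop_last_var_schur.
Qed.

Lemma partn_eq_nth l l' : 0%N \notin l -> 0%N \notin l' ->
  (forall i, nth 0%N l i = nth 0%N l' i) -> l = l'.
Proof.
have size_le s s' : 0%N \notin s -> (forall i, nth 0%N s i = nth 0%N s' i) ->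
    (size s <= size s')%N.
  move=> s0 eqs; rewrite leqNgt; apply/negP => /(mem_nth 0%N).
  by rewrite eqs nth_default // (negPf s0).
move=> l0 l0' eql; apply: (eq_from_nth (x0 := 0%N)) => //; apply/eqP.
by rewrite eqn_leq !size_le.
Qed.

Lemma mcoeff_alternant_schur n l l' N :
    l \in partns n -> l' \in partns n -> (size l <= N)%N ->
  (alternant (xvar K N) N (delta_shift N (fun=> 0%N)) * schur K l' N)
    @_[multinom delta_shift N (nth 0%N l) i | i < N] = (l' == l)%:R.
Proof.
rewrite !mem_partns => /and3P[sortl l0 _] /and3P[sortl' l0' _] leN.
have [leN'|ltN] := leqP (size l') N; last first.
  rewrite schur_eq0 // mulr0 mcoeff0; case: eqP => // ll'.
  by rewrite ll' ltnNge leN in ltN.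
have dec k : sorted geq k -> strict_decr N (delta_shift N (nth 0%N k)).
  by move=> sortk; apply/strict_decr_delta_shift/nth_sorted_geq.
rewrite schur_bialternant // (mcoeff_alternant K (dec _ sortl') (dec _ sortl)).
congr (_ : bool)%:R; apply/forallP/eqP => [eq_nth|-> //]; apply: partn_eq_nth => // i.
have [ltiN|leNi] := ltnP i N; last by rewrite !nth_default // (leq_trans _ leNi).
by have /eqP/addIn := eq_nth (Ordinal ltiN).
Qed.

Lemma schur_coef n (f : varfam K) c l N :
    is_expansion (@schur K) n f c -> l \in partns n -> (size l <= N)%N ->
  (alternant (xvar K N) N (delta_shift N (fun=> 0%N)) * f N)
    @_[multinom delta_shift N (nth 0%N l) i | i < N] = c l.
Proof.
move=> expc ln leN; rewrite expc mulr_sumr raddf_sum (bigD1_seq l) ?partns_uniq //=.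
rewrite -scalerAr mcoeffZ (mcoeff_alternant_schur ln) // eqxx mulr1.
rewrite big_seq_cond big1 ?addr0 // => l' /andP[ln' /negPf neq].
by rewrite -scalerAr mcoeffZ (mcoeff_alternant_schur ln) // neq mulr0.
Qed.

End SchurExpansion.

(* The transition matrix is square, and injective because B is free. *)
Lemma free_family_spans (K : fieldType) (V : lmodType K) (T : eqType) (r : seq T)
    (B C : T -> V) (M : T -> T -> K) :
    uniq r -> {in r, forall l, B l = \sum_(m <- r) M l m *: C m} ->
    (forall c, \sum_(l <- r) c l *: B l = 0 -> {in r, forall l, c l = 0}) ->
  forall c, exists d, \sum_(m <- r) c m *: C m = \sum_(l <- r) d l *: B l.
Proof.
move=> uniq_r BM freeB c; pose elt i := tnth (in_tuple r) i.
have sum_elt (F : T -> V) : \sum_(l <- r) F l = \sum_i F (elt i).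
  by rewrite [LHS](big_tnth _ _ r).
have elt_inj : injective elt by apply/tuple_uniqP.
pose A := \matrix_(i, j) M (elt i) (elt j).
pose coord (v : 'rV[K]_(size r)) l := if [pick i | elt i == l] is Some i then v 0 i else 0.
have coordE v i : coord v (elt i) = v 0 i.
  by rewrite /coord; case: pickP => [j /eqP/elt_inj->//|/(_ i)]; rewrite eqxx.
have sumB v : \sum_(l <- r) coord v l *: B l = \sum_j (v *m A) 0 j *: C (elt j).
  under [RHS]eq_bigr do rewrite mxE scaler_suml.
  rewrite sum_elt [RHS]exchange_big; apply: eq_bigr => i _ /=.
  rewrite coordE BM ?mem_tnth // sum_elt scaler_sumr.
  by apply: eq_bigr => j _; rewrite !mxE scalerA.
have unitA : A \in unitmx.
  rewrite -row_free_unit; apply: inj_row_free => v vA0; apply/rowP => i.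
  rewrite mxE -coordE; apply: freeB (mem_tnth i (in_tuple r)).
  by rewrite sumB vA0 big1 // => j _; rewrite mxE scale0r.
exists (coord (\row_j c (elt j) *m invmx A)).
rewrite sumB mulmxKV // sum_elt.
by apply: eq_bigr => j _; rewrite mxE.
Qed.

Section SchurCoefficients.
Variable K : fieldType.

Lemma size_partn n l : l \in partns n -> (size l <= n)%N.
Proof.
rewrite mem_partns => /and3P[_ l0 /eqP <-]; rewrite sumnE -sum1_size !big_seq leq_sum //.
by move=> k kl; rewrite lt0n; apply: contra l0 => /eqP <-.
Qed.

Lemma schur_expansion n (f : varfam K) :
  homog_symfun n f -> exists c, is_expansion (@schur K) n f c.
Proof.
move=> homf; have [ch fE] := hfun_expansion homf.
have [|||c chE] := @free_family_spans K _ _ (partns n) (fun l => schur K l n)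
  (fun l => hfun K l n) (fun l => bcoef (@hfun K) n (schur K l)) _ _ _ ch.
- exact: partns_uniq.
- by move=> l /homog_symfun_schur/hfun_expansion/bcoef_expansion; apply.
- move=> c c0 l ln; have exp0 : is_expansion (@schur K) n (fun N => 0) c.
    apply: is_expansion_at_degree; last by rewrite c0.
      by move=> l' /homog_symfun_schur.
    by split=> N; rewrite ?rpred0 ?dhomog0 // /drop_last_var raddf0.
  by rewrite -(schur_coef exp0 ln (size_partn ln)) mulr0 mcoeff0.
exists c; apply: is_expansion_at_degree => //; last by rewrite fE.
by move=> l /homog_symfun_schur.
Qed.

Lemma bcoef_schur n (f : varfam K) l N : homog_symfun n f -> l \in partns n ->
    (size l <= N)%N ->
  bcoef (@schur K) n f l = (alternant (xvar K N) N (delta_shift N (fun=> 0%N)) * f N)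
    @_[multinom delta_shift N (nth 0%N l) i | i < N].
Proof.
move=> homf ln leN; have expf := bcoef_expansion (schur_expansion homf).
by rewrite (schur_coef expf ln leN).
Qed.

Lemma mem_partns_row n : row_partn n \in partns n.
Proof. by case: n => [|n]; rewrite mem_partns // /is_partn /= addn0 eqxx. Qed.

Lemma bcoef_schur_row n (f : varfam K) : homog_symfun n f ->
  bcoef (@schur K) n f (row_partn n) = (f 1%N)@_[multinom n | i < 1].
Proof.
move=> homf; rewrite (bcoef_schur (N := 1) homf (mem_partns_row n)); last by case: (n).
rewrite /alternant det_mx11 mxE expr0 mul1r; congr (_@__).
by apply/mnmP => i; rewrite !mnmE ord1 /delta_shift addn0; case: (n).
Qed.

Lemma hfun_univariate l : hfun K l 1 = 'X_ord0 ^+ sumn l.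
Proof.
rewrite /hfun; elim: l => [|k l IHl]; first by rewrite big_nil.
rewrite big_cons IHl /= exprD hsym_Rser Rser_prod big_ord1.
by rewrite /fps_dil /fps_map mpolyC1 mulr1.
Qed.

Lemma mcoeff_univariateX n : ('X_ord0 ^+ n : {mpoly K[1]})@_[multinom n | i < 1] = 1.
Proof.
rewrite mpolyXn mcoeffX (_ : _ == _) //; apply/eqP/mnmP => i.
by rewrite mnmE mulmnE mnm1E [i]ord1 eqxx mul1n.
Qed.

Lemma bcoef_schur_row_hfun n (f : varfam K) : homog_symfun n f ->
  bcoef (@schur K) n f (row_partn n) = \sum_(l <- partns n) bcoef (@hfun K) n f l.
Proof.
move=> homf; rewrite bcoef_schur_row // [f 1%N](bcoef_expansion (hfun_expansion homf)).
rewrite raddf_sum big_seq [RHS]big_seq; apply: eq_bigr => l.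
rewrite mem_partns => /and3P[_ _ /eqP suml].
by rewrite /= mcoeffZ hfun_univariate suml mcoeff_univariateX mulr1.
Qed.

End SchurCoefficients.

Definition fps_shift (A : comNzRingType) k (f : fps A) : fps A :=
  fun n => if (n < k)%N then 0 else f (n - k)%N.

Lemma fps_shift0 (A : comNzRingType) (f : fps A) n : fps_shift 0 f n = f n.
Proof. by rewrite /fps_shift subn0. Qed.

Lemma fps_shiftSS (A : comNzRingType) k (f : fps A) n :
  fps_shift k.+1 f n.+1 = fps_shift k f n.
Proof. by rewrite /fps_shift ltnS subSS. Qed.

Lemma mcoeffXM (R : comNzRingType) N (p : {mpoly R[N]}) (m w : 'X_{1..N}) :
  ('X_[m] * p)@_w = if (m <= w)%MM then p@_(w - m)%MM else 0.
Proof.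
rewrite mulrC; case: ifP => [lemw|/negP nle]; first by rewrite -{1}(submK lemw) addmC mcoeffMX.
apply/eqP; rewrite mcoeff_eq0 (perm_mem (msuppMX _ _)); apply/negP => /mapP[m' _ wE].
by apply: nle; rewrite wE lem_addr.
Qed.

Section JacobiTrudi.
Variables (K : fieldType) (a : fps K).

Lemma mcoeffXM_Rfun N (m w : 'X_{1..N}) n : mdeg w = (mdeg m + n)%N ->
  ('X_[m] * Rfun a n N)@_w = \prod_i fps_shift (m i) a (w i).
Proof.
move=> degw; rewrite mcoeffXM; case: ifP => [/mnm_lepP lemw|/negP nle].
  rewrite mcoeff_Rfun ifT.
    by apply: eq_bigr => i _; rewrite mnmBE /fps_shift ltnNge lemw.
  by rewrite -(eqn_add2l (mdeg m)) -degw addnC -mdegD submK //; apply/mnm_lepP.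
apply/esym/eqP/prodf_eq0; have [i lti] : exists i : 'I_N, ~~ (m i <= w i)%N.
  by apply/existsP; rewrite -negb_forall; apply/negP => /forallP lemw; apply/nle/mnm_lepP.
by exists i => //; rewrite /fps_shift ltnNge lti.
Qed.

Lemma mcoeff_alternant_Rfun N n (v w : nat -> nat) :
    (\sum_(i < N) w i = \sum_(i < N) v i + n)%N ->
  (alternant (xvar K N) N v * Rfun a n N)@_[multinom w i | i < N] =
  \det (\matrix_(i < N, j < N) fps_shift (v j) a (w i)).
Proof.
have mdeg_multinom (u : 'I_N -> nat) : mdeg [multinom u i | i < N] = (\sum_i u i)%N.
  by rewrite mdegE; apply: eq_bigr => i _; rewrite mnmE.
move=> sumw; rewrite alternantE mulr_suml raddf_sum; apply: eq_bigr => s _ /=.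
rewrite -scalerAl mcoeffZ mcoeffXM_Rfun; last first.
  by rewrite !mdeg_multinom sumw [X in (X + _)%N](reindex_inj (@perm_inj _ s)).
by congr (_ * _); apply: eq_bigr => i _; rewrite !mxE !mnmE.
Qed.

Lemma sum_nth_partn n l N : l \in partns n -> (size l <= N)%N ->
  (\sum_(i < N) nth 0 l i = n)%N.
Proof.
rewrite mem_partns => /and3P[_ _ /eqP <-] leN.
rewrite sumnE (big_nth 0%N) big_mkord (big_ord_widen N (nth 0%N l) leN) [RHS]big_mkcond.
by apply: eq_bigr => i _; case: ltnP => // lei; rewrite nth_default.
Qed.

Lemma bcoef_schur_Rfun n l N : a 0%N = 1 -> l \in partns n -> (size l <= N)%N ->
  bcoef (@schur K) n (Rfun a n) l =
  \det (\matrix_(i < N, j < N) fps_shift i a (nth 0 l i + j)%N).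
Proof.
move=> a0 ln leN; rewrite (bcoef_schur (homog_symfun_Rfun n a0) ln leN).
rewrite mcoeff_alternant_Rfun; last first.
  by rewrite /delta_shift big_split /= (sum_nth_partn ln leN) addnC.
congr (\det _); apply/matrixP => i j; rewrite !mxE /fps_shift /delta_shift.
have ltiN := ltn_ord i; have ltjN := ltn_ord j.
have -> : (nth 0 l i + (N.-1 - i) < 0 + (N.-1 - j))%N = (nth 0 l i + j < i)%N by lia.
by case: ltnP => // leil; congr a; lia.
Qed.

End JacobiTrudi.

(** * Hooks *)

Section Hooks.
Variables (K : fieldType) (a : fps K).
Hypothesis a0 : a 0%N = 1.

Definition hook_det m k : K :=
  \det (\matrix_(i < k.+1, j < k.+1) fps_shift i a (nth 0 (m :: nseq k 1) i + j)%N).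

Lemma hook_det0 m : hook_det m 0 = a m.
Proof. by rewrite /hook_det det_mx11 mxE fps_shift0 addn0. Qed.

Lemma hook_detS m k : hook_det m k.+1 = a m * hook_det 1 k - hook_det m.+1 k.
Proof.
rewrite {1}/hook_det (expand_det_col _ ord0) !big_ord_recl big1 => [|i _]; last first.
  by rewrite mxE !lift0 /= nth_nseq ltn_ord addn0 fps_shiftSS /fps_shift mul0r.
rewrite addr0 !mxE !lift0 /= !addn0 fps_shift0 fps_shiftSS fps_shift0 a0 mul1r.
rewrite /cofactor addn0 expr0 mul1r addn0 expr1 mulN1r.
congr (a m * _ - _); congr (\det _); apply/matrixP => i j; rewrite !mxE !lift0.
  by rewrite addnS fps_shiftSS.
by case: i => -[|i] ltik; rewrite /bump /= addnS ?addSn ?fps_shiftSS // !fps_shift0.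
Qed.

Lemma mul_hook_det m k : a m * hook_det 1 k = hook_det m k.+1 + hook_det m.+1 k.
Proof. by rewrite hook_detS subrK. Qed.

Lemma hook_det_0S k : hook_det 0 k.+1 = 0.
Proof. by rewrite hook_detS a0 mul1r subrr. Qed.

Definition column_coef n : K := if n is n'.+1 then hook_det 1 n' else 1.

Lemma column_coefE : column_coef = fps_inv (fps_dil (-1) a).
Proof.
apply: fps_inv_unique; first by rewrite coef0_fps_dil.
apply/fps_ext => -[|n]; first by rewrite coef0_fpsM coef0_fps_dil a0 mul1r.
pose G i := (-1) ^+ i * hook_det i (n.+1 - i).
rewrite coef_fpsM big_ord_recr /= subnn mulr1.
transitivity (\sum_(0 <= i < n.+1) - (G i.+1 - G i) + G n.+1); last first.
  by rewrite sumrN telescope_sumr // opprB subrK /G expr0 mul1r hook_det_0S.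
congr (_ + _); last by rewrite /G subnn hook_det0.
rewrite big_mkord; apply: eq_bigr => i _.
rewrite /G subSS subSn ?leq_ord // /fps_dil -mulrA mul_hook_det exprS; ring.
Qed.

(* F(t) / F(- u t), with u the indeterminate of {poly K} *)
Definition hook_series : fps {poly K} :=
  fps_map polyC a * fps_inv (fps_dil (- 'X) (fps_map polyC a)).

Lemma coef_hook_series n :
  hook_series n = \sum_(j < n.+1) (a (n - j)%N * column_coef j) *: 'X^j.
Proof.
have coef0_map : fps_map polyC a 0%N = 1 by rewrite /fps_map a0.
rewrite /hook_series (_ : - 'X = 'X * (-1)%:P); last by rewrite polyCN mulrN1.
rewrite -fps_dilA fps_inv_dil ?coef0_fps_dil // -fps_map_dil.
rewrite -fps_map_inv ?coef0_fps_dil // -column_coefE mulrC coef_fpsM.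
apply: eq_bigr => j _; rewrite /fps_dil /fps_map -mul_polyC polyCM; ring.
Qed.

Lemma size_hook_series n : (size (hook_series n) <= n.+1)%N.
Proof.
by rewrite coef_hook_series -(poly_def _ (fun j => a (n - j)%N * column_coef j)) size_poly.
Qed.

Lemma hook_series_det n :
  (0 < n)%N -> hook_series n = (1 + 'X) * \sum_(k < n) hook_det (n - k) k *: 'X^k.
Proof.
case: n => // n _; rewrite coef_hook_series mulrDl mul1r mulr_sumr.
transitivity (\sum_(j < n.+2) hook_det (n.+1 - j) j *: 'X^j
              + \sum_(j < n.+1) hook_det (n.+1 - j) j *: 'X^(j.+1) : {poly K}).
  rewrite !(big_ord_recl n.+1) /= subn0 hook_det0 mulr1 -addrA; congr (_ + _).
  rewrite -big_split; apply: eq_bigr => j _ /=.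
  by rewrite /bump /= add1n subSS subSn ?leq_ord // -scalerDl mul_hook_det.
rewrite big_ord_recr /= subnn hook_det_0S scale0r addr0; congr (_ + _).
by apply: eq_bigr => j _; rewrite -scalerAr exprS.
Qed.

End Hooks.

Lemma mem_partns_hook n k : (k < n)%N -> (n - k)%N :: nseq k 1%N \in partns n.
Proof.
move=> ltkn; have nk : (0 < n - k)%N by rewrite subn_gt0.
have sorted_hook : sorted geq ((n - k)%N :: nseq k 1%N).
  by elim: k (n - k)%N nk {ltkn} => //= k IHk m m0; rewrite /geq /= m0 IHk.
rewrite mem_partns /is_partn sorted_hook /= sumn_nseq mul1n subnK ?(ltnW ltkn) // eqxx andbT.
by rewrite inE negb_or mem_nseq andbF andbT eq_sym -lt0n.
Qed.

Lemma bcoef_schur_hook (K : fieldType) (a : fps K) n k : a 0%N = 1 -> (k < n)%N ->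
  bcoef (@schur K) n (Rfun a n) ((n - k)%N :: nseq k 1%N) = hook_det a (n - k) k.
Proof.
move=> a0 ltkn.
by rewrite (bcoef_schur_Rfun (N := k.+1) a0 (mem_partns_hook ltkn)) //= size_nseq.
Qed.

Lemma bcoef_schur_row_Rfun (K : fieldType) (a : fps K) n : a 0%N = 1 ->
  bcoef (@schur K) n (Rfun a n) (row_partn n) = a n.
Proof.
move=> a0; rewrite bcoef_schur_row; last exact: homog_symfun_Rfun.
by rewrite mcoeff_Rfun mdegE !big_ord1 mnmE eqxx.
Qed.

Lemma bcoef_schur_column (K : fieldType) (a : fps K) n : a 0%N = 1 ->
  bcoef (@schur K) n (Rfun a n) (nseq n 1%N) = fps_inv (fps_dil (-1) a) n.
Proof.
move=> a0; rewrite -column_coefE //; case: n => [|n].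
  by rewrite (bcoef_schur_row_Rfun 0).
by have := bcoef_schur_hook a0 (ltnSn n); rewrite subSnn.
Qed.

Theorem theorem2p7 (K : fieldType) (charK0 : [pchar K] =i pred0)
    (a : fps K) (a0 : a 0%N = 1)
    (b : nat -> K) (logF : forall n, (0 < n)%N -> fps_log a n = b n / n%:R) :
  let R := Rfun a in
  (* (a) *)
  [/\ (forall n, bcoef (@schur K) n (R n) (row_partn n) = a n) /\
      (forall n (f : varfam K), homog_symfun n f ->
         bcoef (@schur K) n f (row_partn n) = \sum_(l <- partns n) bcoef (@hfun K) n f l),
  (* (b) *)
      forall n, bcoef (@schur K) n (R n) (nseq n 1%N) =
                fps_inv (fps_dil (-1) a) n,
  (* (c) *)
      [/\ forall k, (0 < k)%N -> forall n,
            bcoef (@hfun K) (k * n) (R (k * n)%N) (nseq n k) =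
            fps_exp (fps_opp (fps_dil (-1) (fps_logser (fun i => b (k * i)%N)))) n,
          forall k, (0 < k)%N -> forall n,
            bcoef (@hfun K) (k * n) (R (k * n)%N) (nseq n k) =
            fps_inv (fps_dil (-1) (fps_exp (fps_logser (fun i => b (k * i)%N)))) n
        & forall n, (0 < n)%N -> bcoef (@hfun K) n (R n) [:: n] = b n],
  (* (d) *)
      forall i j n, (0 < i)%N -> (0 < j)%N -> (i + j)%N = n ->
        bcoef (@hfun K) n (R n) [:: maxn i j; minn i j] =
        if i == j then (b i ^+ 2 - b n) / 2%:R else b i * b j - b n
    & (* (e) *)
      (forall k n, eval_ones k (R n) = fps_pow a k n) /\
  (* (f) *)
      (let P : fps {poly K} :=
         fps_mul (fun m => (a m)%:P) (fps_inv (fps_dil (- 'X) (fun m => (a m)%:P))) in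
       forall n, (0 < n)%N ->
         [/\ (size (P n) <= n.+1)%N,
             (1 + 'X %| P n)%R
           & P n %/ (1 + 'X) =
             \sum_(k < n) bcoef (@schur K) n (R n) ((n - k)%N :: nseq k 1%N) *: 'X^k])].
Proof.
move=> R; have log_a : fps_log a = fps_logser b.
  by apply/fps_ext => -[|n]; [exact: coef0_fps_comp|exact: logF].
split=> [|n|||].
- by split=> [n|n f homf]; [exact: bcoef_schur_row_Rfun|exact: bcoef_schur_row_hfun].
- exact: bcoef_schur_column.
- split=> [k k0 n|k k0 n|n n0]; last exact: bcoef_hfun_row.
    exact: bcoef_hfun_rect.
  by rewrite fps_inv_exp //; apply: bcoef_hfun_rect.
- move=> i j n i0 j0 <-; rewrite (bcoef_hfun_pair charK0 a0 log_a i0 j0).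
  by case: eqVneq => [->|_]; rewrite ?mulr1n // -mulr_natr mulfK ?(natrS_neq0 charK0 1).
split=> [k n|P n n0]; first exact: eval_ones_Rfun.
have X1_neq0 : 1 + 'X != 0 :> {poly K} by rewrite addrC -size_poly_gt0 size_XaddC.
have -> : P n = hook_series a n by [].
rewrite size_hook_series // hook_series_det // dvdp_mulIl mulKp //; split=> //.
by apply: eq_bigr => k _; rewrite bcoef_schur_hook.
Qed.
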